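(* Let $r\in\mathbb{N}$ and $\gamma_1,\ldots,\gamma_r\in\mathbb{C}$ with $\Re\gamma_j>0$ $(1\leqslant j\leqslant r)$. Then, around the origin, $$\prod_{j=1}^r\frac{\left(1-\gamma_j\sum_{k=j}^rt_k\right)\exp\left(\gamma_j\sum_{k=j}^rt_k\right)-1}{\left(\exp\left(\gamma_j\sum_{k=j}^rt_k\right)-1\right)^2}=\sum_{m_1,\ldots,m_r=0}^\infty(-1)^{m_1+\cdots+m_r}\zeta^{\rm des}_r((-m_j);(\gamma_j))\prod_{j=1}^r\frac{t_j^{m_j}}{m_j!}.$$ Hence, for $(k_j)=(k_1,\ldots,k_r)\in\mathbb{N}_0^r$, $$\zeta^{\rm des}_r((-k_j);(\gamma_j))=\prod_{l=1}^r(-1)^{k_l}k_l!\ \times\sum_{(\nu_{dj})}\ \prod_{j=1}^r\left(B_{1+\sum_{l=j}^r\nu_{jl}}\,\gamma_j^{\sum_{l=j}^r\nu_{jl}}\frac{1}{\prod_{d=1}^j\nu_{dj}!}\right),$$ where the sum runs over all families $(\nu_{dj})_{1\leqslant d\leqslant j\leqslant r}$ of non-negative integers such that $\sum_{d=1}^j\nu_{dj}=k_j$ for every $1\leqslant j\leqslant r$.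
   Context: $\mathbb{N}_0=\{0,1,2,\dots\}$. The Bernoulli numbers $B_n$ are defined by $\frac{t}{e^t-1}=\sum_{n\geqslant0}B_n\frac{t^n}{n!}$ (so $B_1=-\frac12$). For $c\in\mathbb{R}$ put $$\widetilde{\mathfrak{H}}_r((t_j);(\gamma_j);c)=\prod_{j=1}^r\left(\frac{1}{\exp\left(\gamma_j\sum_{k=j}^rt_k\right)-1}-\frac{c}{\exp\left(c\gamma_j\sum_{k=j}^rt_k\right)-1}\right),$$ holomorphic in $(t_j)$ around the origin. $\mathcal{C}$ is the Hankel contour: from $+\infty$ along the top side of the positive real axis, once counterclockwise around the origin on a circle of sufficiently small radius $\varepsilon$ (depending on the $\gamma_j$), and back to $+\infty$ along the bottom side; $t^{s-1}$ is taken with $\arg t$ going from $0$ to $2\pi$. The desingularized multiple zeta-function is $$\zeta^{\rm des}_r((s_j);(\gamma_j)):=\lim_{c\to1,\ c\in\mathbb{R}\setminus\{1\}}\frac{(-1)^r}{(c-1)^r}\prod_{k=1}^r\frac{1}{(e^{2\pi is_k}-1)\Gamma(s_k)}\int_{\mathcal{C}^r}\widetilde{\mathfrak{H}}_r((t_j);(\gamma_j);c)\prod_{k=1}^rt_k^{s_k-1}dt_k,$$ which extends to an entire function of $(s_j)\in\mathbb{C}^r$ (the prefactor $1/((e^{2\pi is}-1)\Gamma(s))$ is finite at $s\in\mathbb{Z}_{\leqslant0}$, where it is understood by its limit). *)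

(* Defs.v *)
From HB Require Import structures.
From mathcomp Require Import all_boot all_order all_algebra complex finmap.
From mathcomp Require Import all_classical all_reals all_analysis.
From mathcomp Require Export showcase.summability.

Set Implicit Arguments.
Unset Strict Implicit.
Unset Printing Implicit Defensive.

Import Order.TTheory GRing.Theory Num.Theory numFieldNormedType.Exports.

Local Open Scope classical_set_scope.
Local Open Scope ring_scope.
Local Open Scope complex_scope.

(* R[i] with the topology of its modulus. *)
HB.instance Definition _ (R : rcfType) := NormedModule.copy R[i] R[i]^o.

Section ComplexAnalysis.
Variable R : realType.
Implicit Types (z s : R[i]) (f F : R[i] -> R[i]).

Definition expC z : R[i] :=
  (expR (complex.Re z))%:C * (cos (complex.Im z) +i* sin (complex.Im z)).

(* Gauss: Gamma(z) = lim n! n^z / (z (z+1) ... (z+n)), off the poles. *)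
Definition GammaC z : R[i] :=
  lim (n`!%:R * expC (z * (ln n%:R)%:C) / \prod_(k < n.+1) (z + k%:R)
       @[n --> \oo]).

Definition integralC (D : set R) (f : R -> R[i]) : R[i] :=
  (\int[lebesgue_measure]_(x in D) complex.Re (f x)) +i*
  (\int[lebesgue_measure]_(x in D) complex.Im (f x)).

(* Extension of f over an isolated removable singularity at 0; needed because
   x / 0 = 0 in MathComp. *)
Definition extend0 f z : R[i] :=
  if z == 0 then lim (f w @[w --> (0 : R[i])^']) else f z.

(* Integral of F(t) t^(s-1) dt along the Hankel contour of radius eps.
   t^(s-1) is exp((s-1) log t) with log t = ln |t| + i arg t and arg t running
   from 0 (incoming ray, traversed from +oo to eps) through theta in [0, 2 pi]
   (circle, dt = i eps e^(i theta) dtheta) to 2 pi (outgoing ray). *)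
Definition hankel (eps : R) s F : R[i] :=
  - integralC `[eps, +oo[ (fun x => F x%:C * expC ((s - 1) * (ln x)%:C))
  + integralC `[0, 2 * pi] (fun theta =>
      let t := eps%:C * expC (0 +i* theta) in
      F t * expC ((s - 1) * (ln eps +i* theta)) * ('i * t))
  + integralC `[eps, +oo[ (fun x =>
      F x%:C * expC ((s - 1) * (ln x +i* (2 * pi)))).

(* r-fold integral of F(t) prod_k t_k^(s_k - 1) dt_k over the r-th power of the
   Hankel contour, as an iterated integral (t_1 outermost). *)
Definition hankel_iter (r : nat) (eps : R) (s : 'rV[R[i]]_r)
    (F : 'rV[R[i]]_r -> R[i]) : R[i] :=
  foldr (fun k (G : 'rV[R[i]]_r -> R[i]) (t : 'rV[R[i]]_r) =>
           hankel eps (s 0 k)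
             (fun z => G (\row_j (if j == k then z else t 0 j))))
        F (enum 'I_r) 0.

(* 1 / ((e^(2 pi i s) - 1) Gamma(s)), by its limit at s = 0, -1, -2, ... *)
Definition hankel_prefactor s : R[i] :=
  let f z := ((expC ((2 * pi)%:C * 'i * z) - 1) * GammaC z)^-1 in
  if `[< exists n : nat, s = - n%:R >] then lim (f z @[z --> s^']) else f s.

End ComplexAnalysis.

Section Bernoulli.
Variable R : realType.

Definition bernoulli_gf (B : nat -> R) : Prop :=
  \forall t \near (0 : R[i])^',
    series (fun n => (B n)%:C * t ^+ n / n`!%:R) @ \oo --> t / (expC t - 1).

(* The sequence characterised by its generating function, B_1 = -1/2. *)
Definition bernoulli_number : nat -> R := get bernoulli_gf.

End Bernoulli.

Section Desingularized.
Variables (R : realType) (r : nat).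
Implicit Types (gamma s t : 'rV[R[i]]_r) (j : 'I_r) (c eps : R).

Definition tail_form gamma t j : R[i] :=
  gamma 0 j * \sum_(k < r | (j <= k)%N) t 0 k.

Definition Htilde gamma c t : R[i] :=
  \prod_(j < r)
    extend0 (fun x => (expC x - 1)^-1 - c%:C / (expC (c%:C * x) - 1))
            (tail_form gamma t j).

Definition zeta_des_formula eps gamma s : R[i] :=
  lim ((-1) ^+ r / (c%:C - 1) ^+ r
         * (\prod_(k < r) hankel_prefactor (s 0 k))
         * hankel_iter eps s (Htilde gamma c)
       @[c --> (1 : R)^']).

Definition has_posint s : Prop := exists (k : 'I_r) (n : nat), s 0 k = n.+1%:R.

(* The formula is used as it stands unless some s_k is a positive integer, where
   its prefactor has a pole (e^(2 pi i s_k) = 1 and Gamma(s_k) is finite); there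
   the entire extension is the limit from the arguments without positive integer
   coordinate. The value does not depend on the radius eps of the Hankel contour
   as long as eps is small enough in terms of gamma. *)
Definition zeta_des eps gamma s : R[i] :=
  if `[< has_posint s >] then
    lim (zeta_des_formula eps gamma z
         @[z --> within [set z | ~ has_posint z] (nbhs s)])
  else zeta_des_formula eps gamma s.

(* The families (nu_dj), d <= j, with sum_(d <= j) nu_dj = k_j, as square matrices
   vanishing for j < d. The bound on the entries is no restriction, as
   nu_dj <= k_j. *)
Definition nu_family (k : {ffun 'I_r -> nat})
    (nu : 'M['I_(\max_(j < r) k j).+1]_(r, r)) : bool :=
     [forall d : 'I_r, forall j : 'I_r, (j < d)%N ==> (nu d j == 0 :> nat)]
  && [forall j : 'I_r, (\sum_(d < r | (d <= j)%N) nu d j == k j)%N].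

End Desingularized.

Arguments bernoulli_number R n : clear implicits.
Arguments nu_family {r} k nu.

(* Main.v *)
Require Import Defs.
From mathcomp Require Import all_boot all_order all_algebra complex finmap.
From mathcomp Require Import all_classical all_reals all_analysis.
From mathcomp Require Import measurable_realfun ring lra.

Import Order.TTheory GRing.Theory Num.Theory numFieldNormedType.Exports.

Local Open Scope classical_set_scope.
Local Open Scope ring_scope.
Local Open Scope complex_scope.

(* With h_c(x) = 1/(e^x - 1) - c/(e^(cx) - 1) the function H_c is the product of
   the h_c(x_j), x_j = gamma_j (t_j + ... + t_r), and h_c is given near 0 by the
   power series with coefficients B_(n+1) (1 - c^(n+1)) / (n+1)!. At s = -m the
   integrand of the Hankel integral is single-valued, so the two rays cancel and
   the circle computes 2 pi i times the Taylor coefficient of order m; the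
   iterated integral is therefore (2 pi i)^r times a Taylor coefficient of H_c.
   The factor 1/((e^(2 pi i s) - 1) Gamma(s)) tends to (-1)^m m! / (2 pi i) by
   the pole of Gamma at -m. The coefficient is a finite sum of products of the
   B_(n+1) (1 - c^(n+1)) / (n+1)!, in which dividing by (1 - c)^r and letting c
   tend to 1 turns each factor into B_(n+1) / n!, the coefficient of x^n in the
   derivative ((1 - x) e^x - 1) / (e^x - 1)^2 of x / (e^x - 1). *)

Set Implicit Arguments.
Unset Strict Implicit.
Unset Printing Implicit Defensive.

(** * Modulus and limits in R[i] *)

Section Modulus.
Variable R : realType.
Implicit Types (z w : R[i]) (x : R).

(** The norm of [R[i]] takes its values in [R[i]]; [cabs] is its value in [R], where real
    inequalities can be used. The integrals are never exchanged with an infinite series directly. On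
    the polydisc of radius eps, H_c is a uniform limit of polynomials in t with error O(2^-n); the
    iterated integral is exact on monomials and is carried over by this error, which also shows that
    the inner integrals are measurable. The constants form one chain: the coefficients of h_c and of
    the derivative are bounded by 3 2^n and 2^n, so |x_j| <= 1/8 gives terms O(4^-n). A Cauchy
    product loses a factor n, and n 4^-n <= 2^-n. The sum over (m_j) is taken along finite sets of
    multi-indices, so the expansion must converge absolutely after all linear forms are multiplied
    out. Hence smallness is asked of |gamma_j| (|t_j| + ... + |t_r|), not only of |x_j|. *)

Definition cabs z : R := complex.Re `|z|.

Lemma normC_cabs z : `|z| = (cabs z)%:C.
Proof. by rewrite /cabs RRe_real // ger0_real. Qed.

Lemma cabs_ge0 z : 0 <= cabs z.
Proof. by rewrite -ler0c -normC_cabs. Qed.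

Lemma cabs0 : cabs 0 = 0.
Proof. by apply: complexI; rewrite -normC_cabs normr0. Qed.

Lemma cabs1 : cabs 1 = 1.
Proof. by apply: complexI; rewrite -normC_cabs normr1. Qed.

Lemma cabs_eq0 z : (cabs z == 0) = (z == 0).
Proof. by rewrite -(inj_eq (@complexI R)) -normC_cabs normr_eq0. Qed.

Lemma cabsM z w : cabs (z * w) = cabs z * cabs w.
Proof. by apply: complexI; rewrite rmorphM -!normC_cabs normrM. Qed.

Lemma cabsV z : cabs z^-1 = (cabs z)^-1.
Proof. by apply: complexI; rewrite fmorphV -!normC_cabs normfV. Qed.

Lemma cabsX z n : cabs (z ^+ n) = cabs z ^+ n.
Proof. by apply: complexI; rewrite rmorphXn -!normC_cabs normrX. Qed.

Lemma cabsN z : cabs (- z) = cabs z.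
Proof. by rewrite /cabs normrN. Qed.

Lemma cabsB z w : cabs (z - w) = cabs (w - z).
Proof. by rewrite /cabs distrC. Qed.

Lemma cabsD z w : cabs (z + w) <= cabs z + cabs w.
Proof. by rewrite -lecR rmorphD -!normC_cabs ler_normD. Qed.

Lemma cabs_dist z w : cabs z - cabs w <= cabs (z - w).
Proof. by rewrite lerBlDr; have := cabsD (z - w) w; rewrite subrK. Qed.

Lemma cabs_sum (I : Type) (r : seq I) (P : pred I) (F : I -> R[i]) :
  cabs (\sum_(i <- r | P i) F i) <= \sum_(i <- r | P i) cabs (F i).
Proof.
elim/big_ind2 : _ => [|z x w y zx wy|//]; first by rewrite cabs0.
exact: le_trans (cabsD _ _) (lerD zx wy).
Qed.

Lemma cabs_prod (I : Type) (r : seq I) (P : pred I) (F : I -> R[i]) :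
  cabs (\prod_(i <- r | P i) F i) = \prod_(i <- r | P i) cabs (F i).
Proof. by rewrite (big_morph cabs cabsM cabs1). Qed.

Lemma cabs_real x : cabs x%:C = `|x|.
Proof. by rewrite /cabs normc_def /= expr0n addr0 sqrtr_sqr. Qed.

Lemma cabs_nat n : cabs n%:R = n%:R.
Proof. by rewrite -(rmorph_nat (real_complex R)) cabs_real normr_nat. Qed.

Lemma Re_le_cabs z : `|complex.Re z| <= cabs z.
Proof.
rewrite /cabs normc_def /= -sqrtr_sqr ler_sqrt.
  by rewrite lerDl sqr_ge0.
by rewrite addr_ge0 ?sqr_ge0.
Qed.

Lemma Im_le_cabs z : `|complex.Im z| <= cabs z.
Proof.
rewrite /cabs normc_def /= -sqrtr_sqr ler_sqrt.
  by rewrite lerDr sqr_ge0.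
by rewrite addr_ge0 ?sqr_ge0.
Qed.

Lemma cabs_le_ReIm z : cabs z <= `|complex.Re z| + `|complex.Im z|.
Proof.
rewrite /cabs normc_def /=.
rewrite -(ger0_norm (addr_ge0 (normr_ge0 (complex.Re z)) (normr_ge0 (complex.Im z)))).
rewrite -[leRHS]sqrtr_sqr ler_sqrt ?sqr_ge0 //.
rewrite sqrrD !real_normK ?num_real // lerD2r lerDl.
by rewrite mulrn_wge0 // mulr_ge0.
Qed.

Lemma cvgC_cabsP (T : Type) (F : set_system T) (FF : Filter F)
    (f : T -> R[i]) (l : R[i]) :
  f x @[x --> F] --> l <->
  (forall e : R, 0 < e -> \forall x \near F, cabs (f x - l) < e).
Proof.
split=> [/cvgrPdist_lt fl e e0|fl].
  have := fl e%:C; rewrite ltcR => /(_ e0).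
  by apply: filterS => x; rewrite distrC normC_cabs ltcR.
apply/cvgrPdist_lt => e; rewrite ltcE => /andP[/= /eqP Ime e0].
apply: filterS (fl _ e0) => x; rewrite distrC normC_cabs.
by rewrite ltcE /= -Ime eqxx.
Qed.

Lemma cvgC_cabs (T : Type) (F : set_system T) (FF : Filter F)
    (f : T -> R[i]) (l : R[i]) (g : T -> R) :
  (\forall x \near F, cabs (f x - l) <= g x) -> g x @[x --> F] --> (0 : R) ->
  f x @[x --> F] --> l.
Proof.
move=> fg /cvgrPdist_lt g0; apply/cvgC_cabsP => e e0.
near=> x; apply: (@le_lt_trans _ _ (g x)); first by near: x.
rewrite (le_lt_trans (ler_norm _)) // -normrN -[- g x]add0r.
by near: x; exact: g0.
Unshelve. all: by end_near. Qed.

Lemma nbhsC_cabsP (a : R[i]) (P : set R[i]) :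
  nbhs a P <-> exists2 e : R, 0 < e & forall z, cabs (z - a) < e -> P z.
Proof.
split=> [/nbhs_ballP [e /=]|[e e0 H]].
  rewrite ltcE => /andP[/= /eqP Ime e0] H; exists (complex.Re e) => // z za.
  by apply: H; rewrite -ball_normE /= distrC normC_cabs ltcE /= -Ime eqxx.
apply/nbhs_ballP; exists e%:C => /=; first by rewrite ltcR.
by move=> z; rewrite -ball_normE /= distrC normC_cabs ltcR; exact: H.
Qed.

Lemma dnbhsC_cabsP (a : R[i]) (P : set R[i]) :
  (\forall z \near a^', P z) <->
  exists2 e : R, 0 < e & forall z, z != a -> cabs (z - a) < e -> P z.
Proof.
split=> [/nbhsC_cabsP[e e0 H]|[e e0 H]].
  by exists e => // z za /H; exact.
by apply/nbhsC_cabsP; exists e => // z zae za; exact: H.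
Qed.

Lemma cvgC_eq (T : Type) (F : set_system T) (f g : T -> R[i]) (l m : R[i]) :
  f x @[x --> F] --> l -> f =1 g -> l = m -> g x @[x --> F] --> m.
Proof. by move=> fl /funext <- <-. Qed.

Lemma cvgC_near_eq (T : Type) (F : set_system T) (FF : Filter F)
    (f g : T -> R[i]) (l : R[i]) :
  (\forall x \near F, f x = g x) -> f x @[x --> F] --> l -> g x @[x --> F] --> l.
Proof.
move=> fg /cvgC_cabsP fl; apply/cvgC_cabsP => e e0.
by apply: filterS2 fg (fl e e0) => x ->.
Qed.

(* Stated on unfolded pointwise operations: on big operators, unification with the
   sums and products of functions in [cvgD], [cvgB] and [cvgM] does not return. *)
Lemma cvgCD (T : Type) (F : set_system T) (FF : Filter F) (f g : T -> R[i]) (l m : R[i]) :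
  f x @[x --> F] --> l -> g x @[x --> F] --> m -> f x + g x @[x --> F] --> l + m.
Proof. by move=> fl gm; exact: (cvgD fl gm). Qed.

Lemma cvgCB (T : Type) (F : set_system T) (FF : Filter F) (f g : T -> R[i]) (l m : R[i]) :
  f x @[x --> F] --> l -> g x @[x --> F] --> m -> f x - g x @[x --> F] --> l - m.
Proof. by move=> fl gm; exact: (cvgB fl gm). Qed.

Lemma cvgCM (T : Type) (F : set_system T) (FF : Filter F) (f g : T -> R[i]) (l m : R[i]) :
  f x @[x --> F] --> l -> g x @[x --> F] --> m -> f x * g x @[x --> F] --> l * m.
Proof. by move=> fl gm; exact: (cvgM fl gm). Qed.

Lemma cvgC_unique (T : Type) (F : set_system T) (FF : ProperFilter F)
    (f : T -> R[i]) (l m : R[i]) :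
  f x @[x --> F] --> l -> f x @[x --> F] --> m -> l = m.
Proof.
move=> fl fm; have hR := @norm_hausdorff _ R[i].
by rewrite -(cvg_lim hR fl) -(cvg_lim hR fm).
Qed.

Lemma cvgC_const (T : Type) (F : set_system T) (FF : Filter F)
    (f : T -> R[i]) (l : R[i]) : (forall i, f i = l) -> f x @[x --> F] --> l.
Proof. by move=> /funext ->; exact: cvg_cst. Qed.

Lemma cvgC_S (f : nat -> R[i]) (l : R[i]) :
  f n @[n --> \oo] --> l <-> f n.+1 @[n --> \oo] --> l.
Proof. by rewrite (cvg_shiftS f). Qed.

Lemma cvgC_sum (T I : Type) (F : set_system T) (FF : Filter F) (s : seq I) (P : pred I)
    (f : I -> T -> R[i]) (l : I -> R[i]) : (forall i, f i x @[x --> F] --> l i) ->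
  \sum_(i <- s | P i) f i x @[x --> F] --> \sum_(i <- s | P i) l i.
Proof.
move=> fl; elim: s => [|i s IH].
  by rewrite big_nil; apply: cvgC_const => x; rewrite big_nil.
rewrite big_cons; case: ifP => Pi.
  by apply: cvgC_eq (cvgCD _ (fl i) IH) _ _ => // x; rewrite big_cons Pi.
by apply: cvgC_eq IH _ _ => // x; rewrite big_cons Pi.
Qed.

Lemma cvgC_prod (T I : Type) (F : set_system T) (FF : Filter F) (s : seq I) (P : pred I)
    (f : I -> T -> R[i]) (l : I -> R[i]) : (forall i, f i x @[x --> F] --> l i) ->
  \prod_(i <- s | P i) f i x @[x --> F] --> \prod_(i <- s | P i) l i.
Proof.
move=> fl; elim: s => [|i s IH].
  by rewrite big_nil; apply: cvgC_const => x; rewrite big_nil.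
rewrite big_cons; case: ifP => Pi.
  by apply: cvgC_eq (cvgCM _ (fl i) IH) _ _ => // x; rewrite big_cons Pi.
by apply: cvgC_eq IH _ _ => // x; rewrite big_cons Pi.
Qed.

Lemma cvg_complex (T : Type) (F : set_system T) (FF : Filter F)
    (f : T -> R[i]) (l : R[i]) :
  complex.Re (f x) @[x --> F] --> complex.Re l ->
  complex.Im (f x) @[x --> F] --> complex.Im l -> f x @[x --> F] --> l.
Proof.
move=> /cvgrPdist_lt fr /cvgrPdist_lt fi; apply/cvgC_cabsP => e e0.
have e2 : 0 < e / 2 by rewrite divr_gt0.
apply: filterS2 (fr _ e2) (fi _ e2) => x hr hi.
rewrite cabsB (le_lt_trans (cabs_le_ReIm _)) // [e]splitr.
by move: hr hi; case: (l) (f x) => a b [c d] /= hr hi; rewrite ltrD.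
Qed.

Lemma cvg_real_complex (T : Type) (F : set_system T) (FF : Filter F)
    (f : T -> R) (l : R) :
  f x @[x --> F] --> l -> (f x)%:C @[x --> F] --> l%:C.
Proof. by move=> fl; apply: cvg_complex => //=; exact: cvg_cst. Qed.

Lemma cvgC_Re (T : Type) (F : set_system T) (FF : Filter F)
    (f : T -> R[i]) (l : R[i]) :
  f x @[x --> F] --> l -> complex.Re (f x) @[x --> F] --> complex.Re l.
Proof.
move=> /cvgC_cabsP fl; apply/cvgrPdist_lt => e e0.
apply: filterS (fl e e0) => x; apply: le_lt_trans.
by rewrite cabsB; have := Re_le_cabs (l - f x); case: (l) (f x) => a b [].
Qed.

Lemma cvgC_Im (T : Type) (F : set_system T) (FF : Filter F)
    (f : T -> R[i]) (l : R[i]) :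
  f x @[x --> F] --> l -> complex.Im (f x) @[x --> F] --> complex.Im l.
Proof.
move=> /cvgC_cabsP fl; apply/cvgrPdist_lt => e e0.
apply: filterS (fl e e0) => x; apply: le_lt_trans.
by rewrite cabsB; have := Im_le_cabs (l - f x); case: (l) (f x) => a b [].
Qed.

End Modulus.

(** * Series with geometric bounds *)

Section GeometricSeries.
Variable R : realType.
Implicit Types (u a b : nat -> R[i]) (C q A B : R).

Lemma half_expr_cvg0 C : C * 2^-1 ^+ n @[n --> \oo] --> (0 : R).
Proof.
rewrite -[X in _ --> X](mulr0 C); apply: cvgM; first exact: cvg_cst.
by apply: cvg_expr; rewrite ger0_norm ?invf_lt1 ?ltr1n.
Qed.

Lemma ltn_exp2R n : n.+1%:R <= 2 ^+ n :> R.
Proof. by rewrite -natrX ler_nat ltn_expl. Qed.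

Lemma geo_tail u C q N M : 0 <= q <= 2^-1 ->
  (forall n, cabs (u n) <= C * q ^+ n) -> (N <= M)%N ->
  cabs (\sum_(i < M) u i - \sum_(i < N) u i) <= 2 * C * q ^+ N.
Proof.
move=> /andP[q0 q2] uC /subnKC <-; set k := (M - N)%N.
have C0 : 0 <= C by have := uC 0%N; rewrite expr0 mulr1; apply/le_trans/cabs_ge0.
(* Subtracting the bound of the remaining tail makes the induction close: as 2 q <= 1, each new term
   is paid for by the decrease of 2 C q^n. *)
suff : cabs (\sum_(i < N + k) u i - \sum_(i < N) u i)
         <= 2 * C * q ^+ N - 2 * C * q ^+ (N + k).
  by move=> /le_trans; apply; rewrite gerBl !mulr_ge0 ?exprn_ge0.
elim: k => [|k IH]; first by rewrite addn0 !subrr cabs0.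
rewrite addnS big_ord_recr /= addrAC (le_trans (cabsD _ _)) //.
have := uC (N + k)%N; have := IH.
have : 2 * C * q ^+ (N + k).+1 <= C * q ^+ (N + k).
  have -> : 2 * C * q ^+ (N + k).+1 = (2 * q) * (C * q ^+ (N + k)).
    by rewrite exprS; ring.
  by apply: ler_piMl; [rewrite mulr_ge0 ?exprn_ge0 | lra].
by lra.
Qed.

(** Used with N = 0 to bound a sum, with N = 1 and N = 2 to compare it with its constant or affine
    part, and with general N for truncation errors. *)
Lemma geo_le u C q l N : 0 <= q <= 2^-1 ->
  (forall n, cabs (u n) <= C * q ^+ n) ->
  \sum_(i < n) u i @[n --> \oo] --> l ->
  cabs (l - \sum_(i < N) u i) <= 2 * C * q ^+ N.
Proof.
move=> q12 uC /cvgC_cabsP ul; rewrite leNgt; apply/negP => lt.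
have [M _ HM] : \forall n \near \oo, cabs (\sum_(i < n) u i - l) <
    cabs (l - \sum_(i < N) u i) - 2 * C * q ^+ N by apply: ul; rewrite subr_gt0.
have := HM _ (leq_maxl M N).
have := geo_tail q12 uC (leq_maxr M N).
rewrite (cabsB _ l); set S := \sum_(i < maxn _ _) _; set T := \sum_(i < N) _.
have := cabsD (l - S) (S - T); rewrite addrA subrK.
by lra.
Qed.

Lemma geo_cvg u C q : 0 <= q <= 2^-1 -> (forall n, cabs (u n) <= C * q ^+ n) ->
  exists l : R[i], \sum_(i < n) u i @[n --> \oo] --> l.
Proof.
move=> /andP[q0 q2] uC.
have cv (v : nat -> R) : (forall n, `|v n| <= cabs (u n)) ->
    cvg (\sum_(i < n) v i @[n --> \oo]).
  move=> vu; have -> : (fun n => \sum_(i < n) v i) = series v.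
    by apply/funext => n; rewrite /series /= big_mkord.
  apply: normed_cvg; apply: (series_le_cvg (v_ := geometric C q)) => [n|n|n|].
  - exact: normr_ge0.
  - by rewrite /= (le_trans (cabs_ge0 _) (uC n)).
  - by rewrite /= (le_trans (vu n)).
  - apply: is_cvg_geometric_series.
    by rewrite ger0_norm // (le_lt_trans q2) // invf_lt1 ?ltr1n.
have sum_complex n : \sum_(i < n) u i =
    (\sum_(i < n) complex.Re (u i)) +i* (\sum_(i < n) complex.Im (u i)).
  elim: n => [|n IH]; first by rewrite !big_ord0.
  by rewrite !big_ord_recr /= IH; case: (u n).
exists (lim (\sum_(i < n) complex.Re (u i) @[n --> \oo])
        +i* lim (\sum_(i < n) complex.Im (u i) @[n --> \oo])).
under eq_cvg do rewrite sum_complex.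
apply: cvg_complex => /=.
- exact: (cv (fun n => complex.Re (u n)) (fun n => Re_le_cabs (u n))).
- exact: (cv (fun n => complex.Im (u n)) (fun n => Im_le_cabs (u n))).
Qed.

(* S_N(a) S_N(b) - C_N = sum_(i < N) a_i (S_N(b) - S_(N-i)(b)), each term being
   O(4^-i 4^-(N-i)). *)
Lemma cauchy_product a b A B (x y : R[i]) :
  (forall n, cabs (a n) <= A * 4^-1 ^+ n) ->
  (forall n, cabs (b n) <= B * 4^-1 ^+ n) ->
  \sum_(i < n) a i @[n --> \oo] --> x ->
  \sum_(i < n) b i @[n --> \oo] --> y ->
  \sum_(k < n) \sum_(i < k.+1) a i * b (k - i)%N @[n --> \oo] --> x * y.
Proof.
move=> aA bB ax byy.
have A0 : 0 <= A by have := aA 0%N; rewrite expr0 mulr1; apply/le_trans/cabs_ge0.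
have q4 : 0 <= (4^-1 : R) <= 2^-1 by apply/andP; split; lra.
have conv n : \sum_(k < n) \sum_(i < k.+1) a i * b (k - i)%N =
    \sum_(i < n) a i * \sum_(j < n - i) b j.
  elim: n => [|n IH]; first by rewrite !big_ord0.
  rewrite big_ord_recr /= {}IH [RHS]big_ord_recr /= subSn // subnn.
  rewrite (big_ord_recr n) /= addrA subnn big_ord1; congr (_ + _).
  rewrite -big_split; apply: eq_bigr => i _ /=.
  by rewrite subSn ?(ltnW (ltn_ord i)) // big_ord_recr /= mulrDr.
have prod : (\sum_(i < n) a i) * (\sum_(i < n) b i) @[n --> \oo] --> x * y.
  exact: (cvgCM _ ax byy).
suff err : \sum_(k < n) \sum_(i < k.+1) a i * b (k - i)%N -
    (\sum_(i < n) a i) * (\sum_(i < n) b i) @[n --> \oo] --> (0 : R[i]).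
  by apply: (cvgC_eq (cvgCD _ err prod)) => [n|]; rewrite /= ?subrK ?add0r.
apply: (@cvgC_cabs _ _ _ _ _ _ (fun n => 2 * A * B * 2^-1 ^+ n));
  last exact: half_expr_cvg0.
near=> n; rewrite subr0 conv cabsB mulr_suml -sumrB.
apply: le_trans (cabs_sum _ _ _) _.
apply: (@le_trans _ _ (\sum_(i < n) 2 * A * B * 4^-1 ^+ n)).
  apply: ler_sum => i _; rewrite -mulrBr cabsM.
  have -> : 2 * A * B * 4^-1 ^+ n = (A * 4^-1 ^+ i) * (2 * B * 4^-1 ^+ (n - i)).
    by rewrite -[in LHS](subnKC (ltnW (ltn_ord i))) exprD; ring.
  apply: ler_pM; rewrite ?cabs_ge0 //.
  by apply: geo_tail; rewrite ?leq_subr.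
rewrite sumr_const card_ord -[leLHS]mulr_natr -(mulrA (2 * A * B)) ler_wpM2l //.
  rewrite -mulrA mulr_ge0 // mulr_ge0 //.
  by have := bB 0%N; rewrite expr0 mulr1; apply/le_trans/cabs_ge0.
(* One factor 2^-n absorbs the number n of terms, the other remains. *)
have -> : 4^-1 = 2^-1 * 2^-1 :> R by rewrite -invfM -natrM.
rewrite exprMn -mulrA ler_piMr ?exprn_ge0 ?invr_ge0 //.
rewrite exprVn -ler_pdivlMl ?invr_gt0 ?exprn_gt0 // invrK mulr1.
by apply: le_trans (ltn_exp2R n); rewrite ler_nat.
Unshelve. all: by end_near. Qed.

End GeometricSeries.

(** * The complex exponential *)

Section ComplexExponential.
Variable R : realType.
Implicit Types (z w : R[i]) (x y : R).

Lemma expC0 : expC 0 = 1 :> R[i].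
Proof. by rewrite /expC /= expR0 cos0 sin0 mul1r. Qed.

Lemma expCD z w : expC (z + w) = expC z * expC w.
Proof.
case: z w => a b [c d]; rewrite /expC /= expRD sinD cosD rmorphM /=.
rewrite mulrACA; congr (_ * _); apply/eqP; rewrite eq_complex /=.
by apply/andP; split; apply/eqP => //; ring.
Qed.

Lemma expC_mulrn z n : expC (z *+ n) = expC z ^+ n.
Proof. by elim: n => [|n IH]; rewrite ?expC0 // mulrS exprS expCD IH. Qed.

Lemma expC_real x : expC x%:C = (expR x)%:C.
Proof. by rewrite /expC /= cos0 sin0 mulr1. Qed.

Lemma expCN z : expC (- z) = (expC z)^-1.
Proof.
have eNz : expC (- z) * expC z = 1 by rewrite -expCD addNr expC0.
apply: (@mulIf _ (expC z)); last rewrite mulVf //.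
all: by apply: contra_eq_neq eNz => ->; rewrite mulr0 eq_sym oner_neq0.
Qed.

Lemma cabs_expC_im x : cabs (expC (0 +i* x)) = 1.
Proof.
by rewrite /expC /= expR0 mul1r /cabs normc_def /= cos2Dsin2 sqrtr1.
Qed.

Lemma im_mulrn x n : (0 +i* x : R[i]) *+ n = 0 +i* (x *+ n).
Proof.
elim: n => [|n IH]; rewrite ?mulr0n // !mulrS IH.
by apply/eqP; rewrite eq_complex /= addr0 !eqxx.
Qed.

Lemma expC_2pin n : expC (0 +i* (2 * pi * n%:R)) = 1 :> R[i].
Proof.
rewrite mulr_natr mulr_natl -im_mulrn expC_mulrn /expC /= expR0 mul1r.
by rewrite cos2pi sin2pi expr1n.
Qed.

Lemma cvg_sumS (u : nat -> R[i]) (l : R[i]) :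
  \sum_(i < n) u i @[n --> \oo] --> l ->
  \sum_(i < n) u i.+1 @[n --> \oo] --> l - u 0%N.
Proof.
move=> ul.
have -> : (fun n => \sum_(i < n) u i.+1) = (fun n => \sum_(i < n.+1) u i - u 0%N).
  by apply/funext => n; rewrite big_ord_recl /= addrC addKr.
apply: cvgCB; last exact: cvg_cst.
exact/(cvgC_S (fun n => \sum_(i < n) u i)).
Qed.

Lemma fact_inv_le1 n : n`!%:R^-1 <= 1 :> R.
Proof. by rewrite invf_le1 ?ltr0n ?fact_gt0 // ler1n fact_gt0. Qed.

Lemma cabs_exp_coeff z n : cabs (z ^+ n / n`!%:R) <= 1 * cabs z ^+ n.
Proof.
rewrite cabsM cabsV cabsX cabs_nat mulrC ler_wpM2r ?exprn_ge0 ?cabs_ge0 //.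
exact: fact_inv_le1.
Qed.

(** For z = x + i y this is the Cauchy product of the real exponential series at x with the series
    of cos y + i sin y, reassembled by the binomial theorem. The radius 1/4 is the ratio that
    [cauchy_product] asks for. *)
Lemma expC_series z : cabs z <= 4^-1 ->
  \sum_(i < n) z ^+ i / i`!%:R @[n --> \oo] --> expC z.
Proof.
case: z => x y zle.
set a := fun n => (x%:C : R[i]) ^+ n / n`!%:R.
set b := fun n => (0 +i* y : R[i]) ^+ n / n`!%:R.
have ax : \sum_(i < n) a i @[n --> \oo] --> (expR x)%:C.
  have -> : (fun n => \sum_(i < n) a i) = (fun n => (series (exp_coeff x) n)%:C).
    apply/funext => n; rewrite /series /= big_mkord rmorph_sum.
    by apply: eq_bigr => i _; rewrite /a /exp_coeff /= fmorph_div rmorphXn rmorph_nat.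
  by apply: cvg_real_complex; exact: is_cvg_series_exp_coeff.
have bE n : b n = cos_coeff y n +i* sin_coeff y n.
  have iX k : (0 +i* y : R[i]) ^+ k.*2 = ((-1) ^+ k * y ^+ k.*2)%:C.
    rewrite -mul2n !exprM -exprMn rmorphXn; congr (_ ^+ k).
    by apply/eqP; rewrite eq_complex expr2 /=; apply/andP; split; apply/eqP; ring.
  rewrite /b /cos_coeff /sin_coeff /=.
  have -> : n`!%:R = (n`!%:R : R)%:C :> R[i] by rewrite rmorph_nat.
  rewrite -fmorphV -[in (0 +i* y) ^+ n](odd_double_half n) exprD iX.
  rewrite -[in y ^+ n](odd_double_half n) exprD.
  case: (boolP (odd n)) => on /=; rewrite ?expr0 ?expr1; simpc.
    have -> : n.-1./2 = n./2 by case: (n) on => //= k; rewrite uphalf_half => /negbTE ->.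
    by congr (_ +i* _); ring.
  by congr (_ +i* _); ring.
have bx : \sum_(i < n) b i @[n --> \oo] --> (cos y +i* sin y).
  have -> : (fun n => \sum_(i < n) b i) =
      (fun n => series (cos_coeff y) n +i* series (sin_coeff y) n).
    apply/funext => n; rewrite /series /= !big_mkord.
    elim: n => [|n IH]; first by rewrite !big_ord0.
    by rewrite !big_ord_recr /= IH bE.
  apply: cvg_complex => /=; rewrite unlock.
    exact: is_cvg_series_cos_coeff.
  exact: is_cvg_series_sin_coeff.
have geo w n : cabs w <= 4^-1 -> cabs (w ^+ n / n`!%:R) <= 1 * 4^-1 ^+ n.
  move=> w4; apply: le_trans (cabs_exp_coeff _ _) _.
  by rewrite !mul1r lerXn2r // nnegrE ?cabs_ge0 // invr_ge0.
have x4 : cabs x%:C <= 4^-1 by rewrite cabs_real (le_trans (Re_le_cabs (x +i* y))).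
have y4 : cabs (0 +i* y) <= 4^-1.
  rewrite (le_trans _ (le_trans (Im_le_cabs (x +i* y)) zle)) //=.
  by rewrite /cabs normc_def /= expr0n add0r sqrtr_sqr.
rewrite /expC /=.
have := cauchy_product (fun n => geo _ n x4) (fun n => geo _ n y4) ax bx.
move=> /cvgC_eq; apply=> // n; apply: eq_bigr => k _.
have -> : (x +i* y) = (0 +i* y) + x%:C by simpc.
rewrite exprDn mulr_suml; apply: eq_bigr => i _.
have ik : (i <= k)%N by rewrite -ltnS.
rewrite -(bin_fact ik) !natrM.
have f0 m : m`!%:R != 0 :> R[i] by rewrite pnatr_eq0 -lt0n fact_gt0.
have b0 : 'C(k, i)%:R != 0 :> R[i] by rewrite pnatr_eq0 -lt0n bin_gt0.
have := f0 i; have := f0 (k - i)%N; move: b0.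
set A := 'C(k, i)%:R; set B := i`!%:R; set D := (k - i)`!%:R => A0 D0 B0.
by rewrite /a /b; field; rewrite A0 B0 D0.
Qed.

(** The tail of the exponential series from order 2, with |z| itself as the ratio. *)
Lemma expC_linear z : cabs z <= 4^-1 -> cabs (expC z - 1 - z) <= 2 * cabs z ^+ 2.
Proof.
move=> z4; have q : 0 <= cabs z <= 2^-1.
  by rewrite cabs_ge0 (le_trans z4) // lef_pV2 ?posrE ?ler_nat.
have := geo_le 2 q (cabs_exp_coeff z) (expC_series z4).
rewrite !big_ord_recl big_ord0 /= expr0 expr1 !divr1 addr0 opprD addrA.
by rewrite mulr1.
Qed.

(** Taylor coefficients of (exp z - 1) / z, the reciprocal of the generating function of the
    Bernoulli numbers. *)
Definition expm1_coeff (n : nat) : R := n.+1`!%:R^-1.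

Lemma expm1_series z : z != 0 -> cabs z <= 4^-1 ->
  \sum_(i < n) (expm1_coeff i)%:C * z ^+ i @[n --> \oo] --> (expC z - 1) / z.
Proof.
move=> z0 z4; have /= := cvg_sumS (u := fun i => z ^+ i / i`!%:R) (expC_series z4).
rewrite expr0 divr1 => ez.
have -> : (fun n => \sum_(i < n) (expm1_coeff i)%:C * z ^+ i) =
    (fun n => (\sum_(i < n) z ^+ i.+1 / i.+1`!%:R) * z^-1).
  apply/funext => n; rewrite mulr_suml; apply: eq_bigr => i _.
  rewrite /expm1_coeff fmorphV rmorph_nat exprSr.
  by rewrite -mulrA [_^-1 / z]mulrC mulrA mulfK // mulrC.
exact: (cvgCM _ ez (cvg_cst _)).
Qed.

Lemma expm1_coeff_ge0 n : 0 <= expm1_coeff n.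
Proof. by rewrite invr_ge0. Qed.

Lemma expm1_coeff_le n : expm1_coeff n <= 2^-1 ^+ n.
Proof.
rewrite /expm1_coeff exprVn lef_pV2 ?posrE ?exprn_gt0 ?ltr0n ?fact_gt0 //.
elim: n => [|n IH]; first by rewrite expr0.
rewrite factS natrM exprS ler_pM ?exprn_ge0 //.
by rewrite ler_nat.
Qed.

(** If exp z = 1, the linear estimate gives |z| <= 2 |z|^2 <= |z| / 2. *)
Lemma expC_neq1 z : z != 0 -> cabs z <= 4^-1 -> expC z - 1 != 0.
Proof.
move=> z0 z4; apply: contra_neq z0 => e0; apply/eqP; rewrite -cabs_eq0.
have := expC_linear z4; rewrite e0 sub0r cabsN.
move: (cabs_ge0 z) z4; set t := cabs z => t0 t4 tt; rewrite eq_le t0 andbT.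
by nra.
Qed.

End ComplexExponential.

(** * Bernoulli numbers *)

Section PowerSeries.
Variable R : realType.
Implicit Types (d : nat -> R[i]) (z : R[i]).

Lemma le0_of_linear (a K s0 : R) : 0 < s0 ->
  (forall s, 0 < s <= s0 -> a <= K * s) -> a <= 0.
Proof.
move=> s0_gt0 H; rewrite leNgt; apply/negP => a0.
have K0 : 0 < K.
  by have := H s0; rewrite s0_gt0 lexx => /(_ isT); rewrite -(pmulr_lgt0 K s0_gt0); lra.
pose s := Num.min s0 (a / (2 * K)).
have s_gt0 : 0 < s by rewrite lt_min s0_gt0 divr_gt0 // mulr_gt0.
have := H s; rewrite s_gt0 ge_min lexx => /(_ isT).
apply/negP; rewrite -ltNge (le_lt_trans (y := a / 2)) //; last by lra.
have : s <= a / (2 * K) by rewrite ge_min lexx orbT.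
rewrite ler_pdivlMr ?mulr_gt0 //; lra.
Qed.

(** Once the coefficients below m vanish, dividing by z^m leaves d_m + O(z) = 0; small real values
    of z suffice to conclude d_m = 0. *)
Lemma power_series_unique d (rho : R) : 0 < rho ->
  (forall z, z != 0 -> cabs z <= rho ->
     \sum_(i < n) d i * z ^+ i @[n --> \oo] --> (0 : R[i])) ->
  forall n, d n = 0.
Proof.
move=> rho0 d0.
have cabs_rho : cabs rho%:C = rho by rewrite cabs_real gtr0_norm.
have [C C0 dC] : exists2 C, 0 <= C & forall n, cabs (d n) <= C * rho^-1 ^+ n.
  have rho_neq0 : rho%:C != 0 :> R[i] by rewrite -cabs_eq0 cabs_rho gt_eqF.
  have rho_le : cabs rho%:C <= rho by rewrite cabs_rho.
  have /cvgC_cabsP/(_ 1 ltr01) [N _ HN] := d0 _ rho_neq0 rho_le.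
  pose f n := cabs (d n * rho%:C ^+ n).
  have f0 n : 0 <= f n by exact: cabs_ge0.
  (* From N on, consecutive partial sums have modulus below 1, so a term is below 2; the finite sum
     covers the earlier terms. *)
  exists (2 + \sum_(i < N) f i) => [|n]; first by rewrite addr_ge0 ?sumr_ge0.
  rewrite exprVn ler_pdivlMr ?exprn_gt0 // -{1}cabs_rho -cabsX -cabsM.
  have [nN|Nn] := ltnP n N.
    rewrite (bigD1 (Ordinal nN)) //= addrCA lerDl addr_ge0 ?sumr_ge0 //.
  have := HN n.+1 (leqW Nn); have := HN n Nn; rewrite /= !subr0 big_ord_recr /=.
  set S := \sum_(i < n) _ => S1 S2.
  have := cabs_dist (d n * rho%:C ^+ n) (- S); rewrite opprK cabsN (addrC _ S).
  have : 0 <= \sum_(i < N) f i by rewrite sumr_ge0.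
  by move: S1 S2; lra.
elim/ltn_ind => m IH; apply/eqP; rewrite -cabs_eq0 eq_le cabs_ge0 andbT.
(* The constant is that of [geo_le] for N = 1 and ratio s / rho, which s <= rho / 2 keeps at most
   1/2. *)
apply: (@le0_of_linear _ (2 * (C * rho^-1 ^+ m) * rho^-1) (rho / 2)).
  by rewrite divr_gt0.
move=> s /andP[s0 srho].
have cabs_s : cabs s%:C = s by rewrite cabs_real gtr0_norm.
have s_neq0 : s%:C != 0 :> R[i] by rewrite -cabs_eq0 cabs_s gt_eqF.
have sm : \sum_(i < n) d (m + i)%N * s%:C ^+ i @[n --> \oo] --> (0 : R[i]).
  have : \sum_(i < n + m) d i * s%:C ^+ i @[n --> \oo] --> (0 : R[i]).
    rewrite (cvg_shiftn m (fun n => \sum_(i < n) d i * s%:C ^+ i)).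
    by apply: d0 => //; rewrite cabs_s; lra.
  move=> /(cvgCM _ (cvg_cst ((s%:C ^+ m)^-1))) /cvgC_eq; apply; last by rewrite mulr0.
  move=> n /=; rewrite addnC big_split_ord /= big1 => [|i _]; last first.
    by rewrite IH ?mul0r.
  rewrite add0r mulr_sumr; apply: eq_bigr => i _ /=.
  by rewrite exprD mulrCA; congr (_ * _); rewrite mulrA mulVf ?mul1r // expf_neq0.
have q : 0 <= s / rho <= 2^-1.
  by rewrite divr_ge0 ?(ltW s0) ?(ltW rho0) //= ler_pdivrMr // mulrC.
have bd n : cabs (d (m + n)%N * s%:C ^+ n) <= C * rho^-1 ^+ m * (s / rho) ^+ n.
  rewrite cabsM cabsX cabs_s expr_div_n [s ^+ n * _]mulrC mulrA.
  rewrite ler_wpM2r ?exprn_ge0 ?(ltW s0) //.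
  by rewrite -mulrA -exprVn -exprD.
have := geo_le 1 q bd sm.
rewrite big_ord1 addn0 expr0 mulr1 sub0r cabsN expr1 => /le_trans; apply.
by rewrite (mulrC s) !mulrA.
Qed.

End PowerSeries.

Section BernoulliCoefficients.
Variable R : realType.
Local Notation e := (@expm1_coeff R).

Lemma expm1_coeff0 : e 0 = 1.
Proof. by rewrite /expm1_coeff invr1. Qed.

(** The convolution identity [bern_conv] solved for its last coefficient, as [e 0 = 1]. Each value
    needs all the previous ones, so the recursion builds their list. *)
Fixpoint bern_seq n : seq R :=
  if n is m.+1 then
    rcons (bern_seq m)
      ((m == 0)%:R - \sum_(k < m) nth 0 (bern_seq m) k * e (m - k))
  else [::].

(* [bern n = B_n / n!] *)
Definition bern n := nth 0 (bern_seq n.+1) n.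

Lemma size_bern_seq n : size (bern_seq n) = n.
Proof. by elim: n => //= n IH; rewrite size_rcons IH. Qed.

Lemma nth_bern_seq m n : (n < m)%N -> nth 0 (bern_seq m) n = bern n.
Proof.
elim: m => // m IH; rewrite ltnS leq_eqVlt => /orP[/eqP -> //|nm].
by rewrite [bern_seq _]/= nth_rcons size_bern_seq nm IH.
Qed.

Lemma bern_conv n : \sum_(i < n.+1) bern i * e (n - i) = (n == 0)%:R.
Proof.
rewrite big_ord_recr /= subnn {2}/bern [bern_seq _]/= nth_rcons size_bern_seq.
rewrite ltnn eqxx expm1_coeff0 mulr1 addrC.
under eq_bigr do rewrite nth_bern_seq ?ltn_ord //.
by rewrite subrK.
Qed.

Lemma sum_half_lt n : \sum_(k < n) 2^-1 ^+ (n - k) <= 1 :> R.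
Proof.
suff -> : \sum_(k < n) 2^-1 ^+ (n - k) = 1 - 2^-1 ^+ n :> R.
  by rewrite gerBl exprn_ge0.
elim: n => [|n IH]; first by rewrite big_ord0 subrr.
rewrite big_ord_recr /= subSnn expr1 exprS.
under eq_bigr do rewrite subSn ?(ltnW (ltn_ord _)) // exprS.
by rewrite -mulr_sumr IH; lra.
Qed.

(** By strong induction on the convolution identity: the coefficients e_(n-k) <= 2^-(n-k), k < n,
    sum to at most 1. *)
Lemma bern_le1 n : `|bern n| <= 1.
Proof.
elim/ltn_ind: n => n IH.
have := bern_conv n; rewrite [X in X = _ -> _]big_ord_recr subnn expm1_coeff0 mulr1.
case: n IH => [|n] IH; first by rewrite big_ord0 /= add0r => ->; rewrite normr1.
move=> /= /eqP; rewrite addrC addr_eq0 => /eqP ->.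
rewrite normrN (le_trans (ler_norm_sum _ _ _)) // (le_trans _ (sum_half_lt n.+1)) //.
apply: ler_sum => i _; rewrite normrM (ger0_norm (expm1_coeff_ge0 _ _)).
rewrite -[leRHS]mul1r ler_pM ?expm1_coeff_ge0 ?IH ?expm1_coeff_le //.
Qed.

Lemma cabs_coeff_expr (C : R) (u z : R[i]) (q : R) n :
  cabs u <= C -> cabs z <= q -> cabs (u * z ^+ n) <= C * q ^+ n.
Proof.
move=> uC zq; rewrite cabsM cabsX ler_pM ?cabs_ge0 ?exprn_ge0 ?cabs_ge0 //.
by rewrite lerXn2r // nnegrE ?cabs_ge0 // (le_trans (cabs_ge0 z)).
Qed.

(** The series converges by [bern_le1], and its Cauchy product with the series of (exp z - 1) / z
    has all partial sums equal to 1 from the first term on, so its sum is the reciprocal. *)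
Lemma bern_series (z : R[i]) : z != 0 -> cabs z <= 4^-1 ->
  \sum_(i < n) (bern i)%:C * z ^+ i @[n --> \oo] --> z / (expC z - 1).
Proof.
move=> z0 z4.
have bb n : cabs ((bern n)%:C * z ^+ n) <= 1 * 4^-1 ^+ n.
  by apply: cabs_coeff_expr; rewrite // cabs_real bern_le1.
have ee n : cabs ((e n)%:C * z ^+ n) <= 1 * 4^-1 ^+ n.
  apply: cabs_coeff_expr; rewrite // cabs_real ger0_norm ?expm1_coeff_ge0 //.
  by rewrite (le_trans (expm1_coeff_le _ _)) // exprn_ile1 // ?invf_le1 ?ler1n.
have [|l bl] := @geo_cvg R (fun n => (bern n)%:C * z ^+ n) 1 4^-1 _ bb.
  by apply/andP; split; lra.
suff -> : z / (expC z - 1) = l by [].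
have := cauchy_product bb ee bl (expm1_series z0 z4).
move=> /(@cvg_lim _ (@norm_hausdorff _ _)) lim1.
suff lim2 : \sum_(k < n) \sum_(i < k.+1) (bern i)%:C * z ^+ i *
    ((e (k - i))%:C * z ^+ (k - i)) @[n --> \oo] --> (1 : R[i]).
  move: lim2 => /(@cvg_lim _ (@norm_hausdorff _ _)); rewrite {}lim1 => l1.
  have e1 := expC_neq1 z0 z4.
  apply: (@mulIf _ ((expC z - 1) / z)); first by rewrite mulf_neq0 ?invr_eq0.
  by rewrite l1; field; rewrite z0 e1.
suff conv n : \sum_(k < n.+1) \sum_(i < k.+1) (bern i)%:C * z ^+ i *
    ((e (k - i))%:C * z ^+ (k - i)) = 1.
  by apply/cvgC_S; exact: cvgC_const.
rewrite (eq_bigr (fun k : 'I_n.+1 => ((k == 0 :> nat)%:R : R)%:C * z ^+ k)) => [|k _].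
  rewrite big_ord_recl /= mul1r expr0 big1 ?addr0 // => i _.
  by rewrite /bump /= mul0r.
rewrite -bern_conv rmorph_sum mulr_suml; apply: eq_bigr => i _ /=.
by rewrite mulrACA -exprD subnKC -1?ltnS // rmorphM.
Qed.

(** [bernoulli_number] is chosen by [get] and known only through its generating function: [bern]
    shows that such a sequence exists, and [power_series_unique] identifies the chosen one with
    it. *)
Lemma bernoulli_numberE n : bernoulli_number R n = n`!%:R * bern n.
Proof.
have f0 m : m`!%:R != 0 :> R by rewrite pnatr_eq0 -lt0n fact_gt0.
have bE t : series (fun m => (m`!%:R * bern m)%:C * t ^+ m / m`!%:R) =
    (fun m => \sum_(i < m) (bern i)%:C * t ^+ i).
  apply/funext => m; rewrite /series /= big_mkord; apply: eq_bigr => i _.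
  by rewrite rmorphM rmorph_nat mulrC !mulrA mulVf ?mul1r.
have gf : bernoulli_gf (fun m => m`!%:R * bern m).
  apply/dnbhsC_cabsP; exists 4^-1 => [|z z0]; first by rewrite invr_gt0.
  by rewrite subr0 bE => /ltW; exact: bern_series.
have : bernoulli_gf (bernoulli_number R) by apply: (getPex (ex_intro _ _ gf)).
move=> /dnbhsC_cabsP[rho rho0 H].
pose d m := (bernoulli_number R m / m`!%:R - bern m)%:C.
suff : d n = 0.
  by move=> /complexI/subr0_eq <-; rewrite mulrC divfK.
apply: (@power_series_unique _ _ (Num.min 4^-1 (rho / 2))).
  by rewrite lt_min invr_gt0 divr_gt0 //= ltr0n.
move=> z z0; rewrite le_min => /andP[z4 zr].
have Hz : series (fun n => (bernoulli_number R n)%:C * z ^+ n / n`!%:R) x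
    @[x --> \oo] --> z / (expC z - 1).
  by apply: H => //; rewrite subr0 (le_lt_trans zr) // gtr_pMr // invf_lt1 ?ltr1n.
apply: (cvgC_eq (cvgCB _ Hz (bern_series z0 z4))); rewrite ?subrr // => m.
rewrite /series /= big_mkord -sumrB; apply: eq_bigr => i _.
by rewrite /d rmorphB fmorph_div rmorph_nat mulrBl mulrAC.
Qed.

End BernoulliCoefficients.

(** * Power series of h_c and of the derivative of x / (exp x - 1) *)

Section GeneratingFunctions.
Variable R : realType.
Implicit Types (x z : R[i]) (c : R).
Local Notation e := (@expm1_coeff R).
Local Notation b := (@bern R).

(** At 0 [extend0] is a punctured limit, which the estimate |f w - a 0| <= 2 C A |w| identifies with
    [a 0]. *)
Lemma extend0_series (f : R[i] -> R[i]) (a : nat -> R[i]) (C A rho : R) :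
  0 <= A -> 0 < rho -> A * rho <= 2^-1 ->
  (forall n, cabs (a n) <= C * A ^+ n) ->
  (forall z, z != 0 -> cabs z <= rho ->
     \sum_(i < n) a i * z ^+ i @[n --> \oo] --> f z) ->
  forall z, cabs z <= rho ->
    \sum_(i < n) a i * z ^+ i @[n --> \oo] --> extend0 f z.
Proof.
move=> A0 rho0 Arho aC fz z zrho; rewrite /extend0.
have [->|z0] := eqVneq z 0; last exact: fz.
have -> : lim (f w @[w --> (0 : R[i])^']) = a 0%N.
  apply: cvg_lim => //.
  apply/cvgC_cabsP => d d0; apply/dnbhsC_cabsP.
  have C0 : 0 <= C by have := aC 0%N; rewrite expr0 mulr1; apply/le_trans/cabs_ge0.
  have K0 : 0 < 2 * C * A + 1 by rewrite ltr_wpDl // !mulr_ge0.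
  exists (Num.min rho (d / (2 * C * A + 1))).
    by rewrite lt_min rho0 divr_gt0.
  move=> w w0; rewrite subr0 lt_min => /andP[/ltW wrho].
  rewrite ltr_pdivlMr // => wd.
  have q : 0 <= A * cabs w <= 2^-1.
    by rewrite mulr_ge0 ?cabs_ge0 //= (le_trans _ Arho) // ler_wpM2l.
  have bd n : cabs (a n * w ^+ n) <= C * (A * cabs w) ^+ n.
    by rewrite exprMn mulrA cabsM cabsX ler_wpM2r ?exprn_ge0 ?cabs_ge0.
  have := geo_le 1 q bd (fz w w0 wrho).
  rewrite big_ord1 expr0 mulr1 expr1 => /le_lt_trans; apply; apply: le_lt_trans wd.
  by have := cabs_ge0 w; lra.
apply/cvgC_S.
have H0 n : \sum_(i < n.+1) a i * (0 : R[i]) ^+ i = a 0%N.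
  rewrite big_ord_recl expr0 mulr1 big1 ?addr0 // => i _.
  by rewrite /bump /= expr0n /= mulr0.
exact: cvgC_const.
Qed.

Definition h_coeff c n : R := b n.+1 * (1 - c ^+ n.+1).

Lemma h_coeff_le c n : 0 <= c <= 2 -> cabs (h_coeff c n)%:C <= 3 * 2 ^+ n.
Proof.
move=> /andP[c0 c2]; rewrite cabs_real normrM -[leRHS]mul1r.
rewrite ler_pM ?bern_le1 // (le_trans (ler_normB _ _)) // normr1.
rewrite ger0_norm ?exprn_ge0 //.
have : c ^+ n.+1 <= 2 ^+ n.+1 by rewrite lerXn2r // nnegrE (le_trans c0).
have : 1 <= 2 ^+ n :> R by rewrite exprn_ege1 // ler1n.
by rewrite [2 ^+ n.+1]exprS; lra.
Qed.

(** With beta(x) = x / (exp x - 1), h_c(x) = (beta(x) - beta(c x)) / x, and the constant terms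
    cancel. The range of c keeps c nonzero and |c x| <= 1/4. *)
Lemma h_series c x : 2^-1 <= c <= 2 -> x != 0 -> cabs x <= 8^-1 ->
  \sum_(i < n) (h_coeff c i)%:C * x ^+ i @[n --> \oo] -->
    (expC x - 1)^-1 - c%:C / (expC (c%:C * x) - 1).
Proof.
move=> /andP[c2 c2'] x0 x8.
have c0 : 0 < c by lra.
have cC0 : c%:C != 0 :> R[i] by rewrite -cabs_eq0 cabs_real gtr0_norm // gt_eqF.
have x4 : cabs x <= 4^-1 by lra.
have cx4 : cabs (c%:C * x) <= 4^-1.
  by rewrite cabsM cabs_real gtr0_norm //; have := cabs_ge0 x; nra.
have cx0 : c%:C * x != 0 by rewrite mulf_neq0.
have := cvg_sumS (u := fun i => (b i)%:C * x ^+ i - (b i)%:C * (c%:C * x) ^+ i) .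
move=> /(_ (x / (expC x - 1) - c%:C * x / (expC (c%:C * x) - 1))).
have -> : (fun n => \sum_(i < n) ((b i)%:C * x ^+ i - (b i)%:C * (c%:C * x) ^+ i)) =
    (fun n => \sum_(i < n) (b i)%:C * x ^+ i - \sum_(i < n) (b i)%:C * (c%:C * x) ^+ i).
  by apply/funext => n; rewrite sumrB.
move=> /(_ (cvgCB _ (bern_series x0 x4) (bern_series cx0 cx4))) /= lim1.
apply: (cvgC_eq (cvgCM _ lim1 (cvg_cst x^-1))) => [n|] /=.
  rewrite mulr_suml; apply: eq_bigr => i _; rewrite /h_coeff.
  by rewrite rmorphM rmorphB rmorphXn rmorph1 exprMn !exprSr; field.
have e1 := expC_neq1 x0 x4; have e2 := expC_neq1 cx0 cx4.
by rewrite !expr0 subrr subr0; field; rewrite x0 e1 e2.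
Qed.

Definition phi_coeff n : R := n.+1%:R * b n.+1.

Lemma phi_coeff_le n : cabs (phi_coeff n)%:C <= 1 * 2 ^+ n.
Proof.
rewrite cabs_real normrM normr_nat mul1r -[leRHS]mulr1 ler_pM ?bern_le1 //.
exact: ltn_exp2R.
Qed.

(* With [beta = x / (exp x - 1)] and [E = 1 / beta], the derivative [D] of [beta]
   is obtained coefficientwise from [D E + beta E' = 0]. *)
Lemma phi_series x : x != 0 -> cabs x <= 8^-1 ->
  \sum_(i < n) (phi_coeff i)%:C * x ^+ i @[n --> \oo] -->
    ((1 - x) * expC x - 1) / (expC x - 1) ^+ 2.
Proof.
move=> x0 x8; have x4 : cabs x <= 4^-1 by lra.
pose e' n := n.+1%:R * e n.+1.
(* The coefficients are bounded by 2^n only; the radius 1/8 brings the ratio back to 1/4. *)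
have pp n : cabs ((phi_coeff n)%:C * x ^+ n) <= 1 * 4^-1 ^+ n.
  have -> : 1 * 4^-1 ^+ n = 1 * 2 ^+ n * 8^-1 ^+ n :> R.
    by rewrite !mul1r -exprMn; congr (_ ^+ _); field.
  rewrite cabsM cabsX ler_pM ?cabs_ge0 ?exprn_ge0 ?cabs_ge0 ?phi_coeff_le //.
  by rewrite lerXn2r // nnegrE ?cabs_ge0 // invr_ge0.
have bb n : cabs ((b n)%:C * x ^+ n) <= 1 * 4^-1 ^+ n.
  by apply: cabs_coeff_expr; rewrite // cabs_real bern_le1.
have ee n : cabs ((e n)%:C * x ^+ n) <= 1 * 4^-1 ^+ n.
  apply: cabs_coeff_expr; rewrite // cabs_real ger0_norm ?expm1_coeff_ge0 //.
  by rewrite (le_trans (expm1_coeff_le _ _)) // exprn_ile1 // ?invf_le1 ?ler1n.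
(* Coefficientwise form of E' = E - (E - 1) / x; it gives both the bound on [e'] and the sum of its
   series. *)
have e'E n : e' n = e n - e n.+1.
  rewrite /e' /expm1_coeff (factS n.+1) natrM -[n.+2%:R]natr1.
  have : n.+1`!%:R != 0 :> R by rewrite pnatr_eq0 -lt0n fact_gt0.
  have : n.+1%:R + 1 != 0 :> R by rewrite natr1 pnatr_eq0.
  by move: (n.+1%:R : R) (n.+1`!%:R : R) => N F u v; field; rewrite u v.
have ee' n : cabs ((e' n)%:C * x ^+ n) <= 1 * 4^-1 ^+ n.
  apply: cabs_coeff_expr; rewrite // cabs_real ger0_norm; last first.
    by rewrite mulr_ge0 ?expm1_coeff_ge0.
  rewrite e'E lerBlDr (le_trans (expm1_coeff_le _ _)) //.
  by rewrite (le_trans (exprn_ile1 _ _ _)) ?invf_le1 ?ler1n // lerDl expm1_coeff_ge0.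
have q4 : 0 <= (4^-1 : R) <= 2^-1 by apply/andP; split; lra.
have [D pD] := geo_cvg q4 pp.
have eE := expm1_series x0 x4.
have e1 := expC_neq1 x0 x4.
have eE' : \sum_(i < n) (e' i)%:C * x ^+ i @[n --> \oo] -->
    (expC x - 1) / x - ((expC x - 1) / x - 1) / x.
  have := cvg_sumS (u := fun i => (e i)%:C * x ^+ i) eE.
  rewrite expm1_coeff0 expr0 mulr1 rmorph1 => s1.
  apply: (cvgC_eq (cvgCB _ eE (cvgCM _ s1 (cvg_cst x^-1)))) => //= n.
  transitivity (\sum_(i < n) (e i)%:C * x ^+ i -
    (\sum_(i < n) (e i.+1)%:C * x ^+ i.+1) / x); first by [].
  rewrite mulr_suml -sumrB; apply: eq_bigr => i _.
  by rewrite e'E rmorphB exprSr; field.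
pose L := D * ((expC x - 1) / x) +
  x / (expC x - 1) * ((expC x - 1) / x - ((expC x - 1) / x - 1) / x).
have sumL : \sum_(k < n) \sum_(i < k.+1)
      (phi_coeff i)%:C * x ^+ i * ((e (k - i))%:C * x ^+ (k - i)) +
    \sum_(k < n) \sum_(i < k.+1)
      (b i)%:C * x ^+ i * ((e' (k - i)%N)%:C * x ^+ (k - i)) @[n --> \oo] --> L.
  exact: (cvgCD _ (cauchy_product pp ee pD eE)
               (cauchy_product bb ee' (bern_series x0 x4) eE')).
have : L = 0.
  apply: (cvgC_unique _ sumL); apply: cvgC_const => n.
  rewrite -big_split big1 // => k _ /=.
  transitivity ((\sum_(i < k.+1) (i.+1%:R * b i.+1 * e (k - i)%N
                 + b i * ((k - i).+1%:R * e (k - i).+1)))%:C * x ^+ k); last first.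
    suff -> : \sum_(i < k.+1) (i.+1%:R * b i.+1 * e (k - i)%N
                 + b i * ((k - i).+1%:R * e (k - i).+1)) = 0 by rewrite mul0r.
    (* Leibniz rule: writing k+1 = i + (k+1-i) splits k+1 times the coefficient of x^(k+1) in beta E
       = 1, which is zero. *)
    transitivity (k.+1%:R * \sum_(i < k.+2) b i * e (k.+1 - i)%N); last first.
      by rewrite bern_conv mulr0.
    have -> : k.+1%:R * (\sum_(i < k.+2) b i * e (k.+1 - i)%N) =
        \sum_(i < k.+2) i%:R * b i * e (k.+1 - i)%N +
        \sum_(i < k.+2) b i * ((k.+1 - i)%:R * e (k.+1 - i)%N).
      rewrite mulr_sumr -big_split; apply: eq_bigr => i _ /=.
      have -> : k.+1%:R = i%:R + (k.+1 - i)%:R :> R.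
        by rewrite -natrD subnKC // -ltnS.
      by ring.
    rewrite big_split; congr (_ + _).
      rewrite [RHS]big_ord_recl !mul0r add0r; apply: eq_bigr => i _ /=.
      by rewrite /bump /= add1n subSS.
    rewrite [RHS]big_ord_recr /= subnn mul0r mulr0 addr0; apply: eq_bigr => i _.
    by rewrite subSn // -ltnS.
  rewrite rmorph_sum mulr_suml -big_split; apply: eq_bigr => i _ /=.
  rewrite [(_ + _)%:C]rmorphD mulrDl; congr (_ + _).
    rewrite mulrACA -exprD subnKC -1?ltnS //; congr (_ * _).
    by rewrite /phi_coeff !rmorphM.
  rewrite mulrACA -exprD subnKC -1?ltnS //; congr (_ * _).
  by rewrite /e' !rmorphM.
rewrite /L => /eqP; rewrite addr_eq0 => /eqP DE.
suff -> : ((1 - x) * expC x - 1) / (expC x - 1) ^+ 2 = D by exact: pD.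
apply: (@mulIf _ ((expC x - 1) / x)); first by rewrite mulf_neq0 ?invr_eq0.
by rewrite DE; field; rewrite x0 e1.
Qed.

Lemma extend0_h_series c x : 2^-1 <= c <= 2 -> cabs x <= 8^-1 ->
  \sum_(i < n) (h_coeff c i)%:C * x ^+ i @[n --> \oo] -->
    extend0 (fun x => (expC x - 1)^-1 - c%:C / (expC (c%:C * x) - 1)) x.
Proof.
move=> c12; apply: (@extend0_series _ (fun n => (h_coeff c n)%:C) 3 2) => //; first by lra.
- by move=> n; apply: h_coeff_le; lra.
- by move=> z z0 z8; exact: h_series.
Qed.

Lemma extend0_phi_series x : cabs x <= 8^-1 ->
  \sum_(i < n) (phi_coeff i)%:C * x ^+ i @[n --> \oo] -->
    extend0 (fun x => ((1 - x) * expC x - 1) / (expC x - 1) ^+ 2) x.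
Proof.
apply: (@extend0_series _ (fun n => (phi_coeff n)%:C) 1 2) => //; first by lra.
- by move=> n; exact: phi_coeff_le.
- by move=> z z0 z8; exact: phi_series.
Qed.

End GeneratingFunctions.

(** * Gamma near its poles *)

Section Gamma.
Variable R : realType.
Implicit Types (z w : R[i]).

Lemma cabs_lim_le (T : Type) (F : set_system T) (FF : ProperFilter F)
    (f : T -> R[i]) (l a : R[i]) (B : R) :
  f x @[x --> F] --> l -> (\forall x \near F, cabs (f x - a) <= B) ->
  cabs (l - a) <= B.
Proof.
move=> /cvgC_cabsP fl fB; rewrite leNgt; apply/negP => lt.
have e0 : 0 < cabs (l - a) - B by rewrite subr_gt0.
have [x []] := filter_ex (filterI (fl _ e0) fB).
have := cabsD (l - f x) (f x - a); rewrite addrA subrK (cabsB l (f x)).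
by lra.
Qed.

(** For v the real or imaginary part of u, v + t is nonincreasing from N on and bounded below, hence
    converges, and t tends to 0. *)
Lemma cvgC_telescope (u : nat -> R[i]) (t : nat -> R) (N : nat) :
  (forall n, 0 <= t n) -> t n @[n --> \oo] --> (0 : R) ->
  (forall n, (N <= n)%N -> cabs (u n.+1 - u n) <= t n - t n.+1) ->
  exists2 l : R[i], u n @[n --> \oo] --> l & cabs (l - u N) <= t N.
Proof.
move=> t0 tcvg ut.
have utN n k : (N <= n)%N -> cabs (u (n + k)%N - u n) <= t n - t (n + k)%N.
  move=> Nn; elim: k => [|k IH]; first by rewrite addn0 !subrr cabs0.
  have := ut (n + k)%N (leq_trans Nn (leq_addr _ _)); rewrite addnS => ut1.
  have := cabsD (u (n + k).+1 - u (n + k)%N) (u (n + k)%N - u n).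
  by rewrite addrA subrK; lra.
have cv (v : nat -> R) : (forall n m, `|v m - v n| <= cabs (u m - u n)) ->
    exists l : R, v n @[n --> \oo] --> l.
  move=> vu.
  have noninc : {homo (fun n => v (n + N)%N + t (n + N)%N) : n m / (n <= m)%N >-> n >= m}.
    apply/nonincreasing_seqP => n.
    have := ut (n + N)%N (leq_addl _ _); have := vu (n + N)%N (n.+1 + N)%N.
    by rewrite !addSn; have := ler_norm (v (n + N).+1 - v (n + N)%N); lra.
  have lb : has_lbound (range (fun n => v (n + N)%N + t (n + N)%N)).
    exists (v N - t N) => _ [n _ <-].
    have := utN N n (leqnn _); have := vu (N + n)%N N.
    have := ler_norm (v N - v (N + n)%N); rewrite (addnC n) cabsB.
    by have := t0 (N + n)%N; lra.
  have /cvg_ex [l vl] := nonincreasing_is_cvgn noninc lb.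
  exists l; rewrite -(cvg_shiftn N).
  have -> : (fun n => v (n + N)%N) =
      (fun n => (v (n + N)%N + t (n + N)%N) - t (n + N)%N).
    by apply/funext => n; rewrite addrK.
  rewrite -[l]subr0; apply: (cvgB vl).
  by rewrite (cvg_shiftn N t).
have [|lr vr] := cv (fun n => complex.Re (u n)).
  by move=> n m; have := Re_le_cabs (u m - u n); case: (u n) (u m) => a b [].
have [|li vi] := cv (fun n => complex.Im (u n)).
  by move=> n m; have := Im_le_cabs (u m - u n); case: (u n) (u m) => a b [].
have ul : u n @[n --> \oo] --> (lr +i* li) by apply: cvg_complex.
exists (lr +i* li) => //; apply: (cabs_lim_le _ ul).
exists N => // n /= /subnKC <-.
by apply: le_trans (utN N (n - N)%N (leqnn _)) _; rewrite gerBl.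
Qed.

(** Gauss's approximant of w Gamma(w) = Gamma(1 + w): the factor of the product that vanishes at w =
    0 is left out, so the value there is 1. *)
Definition gamma_quot (n : nat) w : R[i] :=
  n`!%:R * expC (w * (ln n%:R)%:C) / \prod_(k < n) (w + k.+1%:R).

(** Let l = ln((n+2)/(n+1)). The quotient of consecutive terms minus 1 is (n+2)/(w+n+2) times (exp(w
    l) - 1 - w l) + w (l - 1/(n+2)). As l lies between 1/(n+2) and 1/(n+1), both parts are O(|w|
    (1/(n+1) - 1/(n+2))), a bound that telescopes. *)
Lemma gamma_quot_step n w : cabs w <= 16^-1 ->
  cabs (gamma_quot n.+2 w - gamma_quot n.+1 w) <=
    cabs (gamma_quot n.+1 w) * (8 * cabs w) * (n.+1%:R^-1 - n.+2%:R^-1).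
Proof.
move=> w16; have w0 := cabs_ge0 w.
pose a : R := n.+1%:R^-1; pose b : R := n.+2%:R^-1.
pose l : R := ln n.+2%:R - ln n.+1%:R.
have n1 : (n.+1%:R : R) \in Num.pos by rewrite posrE.
have n2 : (n.+2%:R : R) \in Num.pos by rewrite posrE.
have n1_gt0 : 0 < n.+1%:R :> R by [].
have n2E : n.+2%:R = n.+1%:R + 1 :> R by rewrite natr1.
have n1_ge1 : 1 <= n.+1%:R :> R by rewrite ler1n.
have ab : a - b = a * b by rewrite /a /b n2E; field; rewrite !gt_eqF //; lra.
have b_gt0 : 0 < b by rewrite invr_gt0.
have a_gt0 : 0 < a by rewrite invr_gt0.
have a2b : a <= 2 * b.
  rewrite /a /b -ler_pdivrMr ?invr_gt0 // invrK mulrC ler_pdivrMr // n2E; lra.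
have la : l <= a.
  rewrite /l -ln_div // n2E mulrDl divff ?gt_eqF // mul1r le_ln1Dx //.
  by rewrite (lt_trans _ a_gt0) // ltrN10.
have lb : b <= l.
  rewrite /l -[l in _ <= l]opprB lerNr -ln_div //.
  have -> : n.+1%:R / n.+2%:R = 1 + - b :> R.
    by rewrite /b n2E; field; rewrite gt_eqF //; lra.
  by rewrite le_ln1Dx // ltrN2 /b invf_lt1 ?ltr1n.
have wn2 : 2^-1 * n.+2%:R <= cabs (w + n.+2%:R).
  have := cabs_dist n.+2%:R (- w); rewrite opprK cabsN cabs_nat addrC.
  by rewrite (addrC w) n2E; lra.
have wn2_neq0 : w + n.+2%:R != 0.
  by rewrite -cabs_eq0 gt_eqF // (lt_le_trans _ wn2) // mulr_gt0 // invr_gt0.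
have cn2_neq0 : n.+2%:R != 0 :> R[i] by rewrite pnatr_eq0.
have step : gamma_quot n.+2 w - gamma_quot n.+1 w = gamma_quot n.+1 w *
    ((expC (w * l%:C) - 1 - w * l%:C + w * (l - b)%:C) *
     (n.+2%:R / (w + n.+2%:R))).
  have -> : (l - b)%:C = l%:C - n.+2%:R^-1 :> R[i].
    by rewrite rmorphB fmorphV rmorph_nat.
  rewrite /gamma_quot big_ord_recr /= factS natrM.
  have -> : w * (ln n.+2%:R)%:C = w * l%:C + w * (ln n.+1%:R)%:C.
    by rewrite -mulrDr -rmorphD subrK.
  rewrite expCD invfM.
  set P := (\prod_(k < n.+1) _)^-1; set E := expC (w * (ln _)%:C).
  set L := l%:C; set F := n.+1`!%:R; set e := expC _.
  move: wn2_neq0 cn2_neq0; move: (n.+2%:R : R[i]) => N2 h1 h2.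
  by field; rewrite h1 h2.
rewrite step cabsM -mulrA ler_wpM2l ?cabs_ge0 // cabsM.
have fac : cabs (n.+2%:R / (w + n.+2%:R)) <= 2.
  rewrite cabsM cabsV cabs_nat ler_pdivrMr; first by lra.
  by rewrite (lt_le_trans _ wn2) // mulr_gt0 // invr_gt0.
have ule : cabs (w * l%:C) <= cabs w * a.
  rewrite cabsM cabs_real ler_wpM2l // ger0_norm //; lra.
have a1 : a <= 1 by rewrite invf_le1.
have u4 : cabs (w * l%:C) <= 4^-1.
  by apply: le_trans ule _; nra.
have num : cabs (expC (w * l%:C) - 1 - w * l%:C + w * (l - b)%:C)
    <= 2 * (cabs w * (a - b)).
  apply: le_trans (cabsD _ _) _.
  have := expC_linear u4.
  have : cabs (w * l%:C) ^+ 2 <= cabs w * (4^-1 * (a - b)).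
    apply: (@le_trans _ _ ((cabs w * a) ^+ 2)).
      by rewrite lerXn2r // nnegrE ?cabs_ge0 // mulr_ge0 // ltW.
    rewrite exprMn expr2 -mulrA ler_wpM2l // ab expr2.
    have : a * a <= 2 * (a * b) by rewrite mulrCA ler_wpM2l // ltW.
    have : 0 <= a * a by rewrite mulr_ge0 // ltW.
    by nra.
  have : cabs (w * (l - b)%:C) <= cabs w * (a - b).
    by rewrite cabsM cabs_real ler_wpM2l // ger0_norm ?subr_ge0 // lerD2r.
  have : 0 <= cabs w * (a - b) by rewrite mulr_ge0 // ab mulr_ge0 // ltW.
  by nra.
apply: le_trans (ler_pM (cabs_ge0 _) (cabs_ge0 _) num fac) _.
have : 0 <= cabs w * (a - b) by rewrite mulr_ge0 // ab mulr_ge0 // ltW.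
by rewrite -/a -/b; nra.
Qed.

Lemma gamma_quot1 w : cabs w <= 16^-1 -> cabs (gamma_quot 1 w - 1) <= 2 * cabs w.
Proof.
move=> w16; have w0 := cabs_ge0 w.
have w1 : 2^-1 <= cabs (w + 1).
  by have := cabs_dist 1 (- w); rewrite opprK cabsN cabs1 addrC (addrC w); lra.
have w1_neq0 : w + 1 != 0 by rewrite -cabs_eq0 gt_eqF // (lt_le_trans _ w1) // invr_gt0.
rewrite /gamma_quot big_ord1 ln1 mulr0 expC0 mulr1.
have -> : 1%:R / (w + 1%:R) - 1 = - w / (w + 1) :> R[i] by field.
rewrite cabsM cabsV cabsN mulrC ler_wpM2r // invf_ple ?posrE //.
by rewrite (lt_le_trans _ w1) // invr_gt0.
Qed.

Lemma gamma_quot_bounded n w : cabs w <= 16^-1 -> cabs (gamma_quot n.+1 w) <= 4.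
Proof.
move=> w16; have w0 := cabs_ge0 w.
(* This bound reproduces itself: it is at most 4 for |w| <= 1/16, and with 4 in [gamma_quot_step]
   the next increment is 32 |w| (1/(n+1) - 1/(n+2)). *)
suff : cabs (gamma_quot n.+1 w) <= 2 + 32 * cabs w * (1 - n.+1%:R^-1).
  have : 0 <= cabs w * n.+1%:R^-1 by rewrite mulr_ge0 // invr_ge0.
  by move: (n.+1%:R^-1 : R) (cabs w) w16 => x y; lra.
elim: n => [|n IH].
  rewrite invr1 subrr mulr0 addr0.
  by have := gamma_quot1 w16; have := cabs_dist (gamma_quot 1 w) 1; rewrite cabs1; lra.
have := gamma_quot_step n w16.
have := cabs_dist (gamma_quot n.+2 w) (gamma_quot n.+1 w).
set x := n.+1%:R^-1 in IH *; set y := n.+2%:R^-1.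
have yx : y <= x by rewrite lef_pV2 ?posrE // ler_nat.
have x0 : 0 <= x by rewrite invr_ge0.
set G := cabs (gamma_quot n.+1 w) in IH *; move=> h1 h2.
have wx : 0 <= cabs w * x by rewrite mulr_ge0.
have G4 : G <= 4 by apply: le_trans IH _; lra.
have : G * (8 * cabs w) * (x - y) <= 4 * (8 * cabs w) * (x - y).
  by rewrite ler_wpM2r ?subr_ge0 // ler_wpM2r // mulr_ge0.
by nra.
Qed.

(** In 34, 32 comes from the telescoped increments and 2 from the first term. The rate in |w| yields
    the limit 1 as w tends to 0. *)
Lemma gamma_quot_cvg w : cabs w <= 16^-1 ->
  exists2 l : R[i], gamma_quot n w @[n --> \oo] --> l & cabs (l - 1) <= 34 * cabs w.
Proof.
move=> w16; have w0 := cabs_ge0 w.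
pose t n : R := 32 * cabs w * n.+1%:R^-1.
have [||n _|l ql l1] := @cvgC_telescope (fun n => gamma_quot n.+1 w) t 0.
- by move=> n; rewrite !mulr_ge0 // invr_ge0.
- rewrite -[X in _ --> X](mulr0 (32 * cabs w)).
  exact: (cvgM (cvg_cst _) cvg_harmonic).
- apply: le_trans (gamma_quot_step n w16) _; rewrite -mulrBr.
  rewrite ler_wpM2r ?subr_ge0 ?lef_pV2 ?posrE ?ler_nat //.
  have := gamma_quot_bounded n w16; nra.
exists l; first exact/cvgC_S.
have := gamma_quot1 w16; have := cabsD (l - gamma_quot 1 w) (gamma_quot 1 w - 1).
by rewrite addrA subrK; move: l1; rewrite /t invr1 mulr1; lra.
Qed.

Definition gamma_seq n z : R[i] :=
  n`!%:R * expC (z * (ln n%:R)%:C) / \prod_(k < n.+1) (z + k%:R).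

Lemma gamma_seq_quot n w : gamma_seq n w = gamma_quot n w / w.
Proof.
rewrite /gamma_seq big_ord_recl addr0 [(w * _)^-1]invfM mulrCA mulrC.
by congr (_ / _ / _).
Qed.

(** The functional equation Gamma(z) = Gamma(z+1) / z before the limit; the correction 1 +
    (z+1)/(n+1) tends to 1. *)
Lemma gamma_seq_shift n z : (forall k, z + k%:R != 0) ->
  gamma_seq n.+1 z = gamma_seq n.+1 (z + 1) * ((1 + (z + 1) / n.+1%:R) / z).
Proof.
move=> zk; have z0 := zk 0%N; rewrite addr0 in z0.
have zn := zk n.+2.
have n0 : n.+1%:R != 0 :> R[i] by rewrite pnatr_eq0.
have -> : 1 + (z + 1) / n.+1%:R = (z + n.+2%:R) / n.+1%:R.
  by rewrite -[n.+2%:R]natr1; move: (n.+1%:R : R[i]) n0 => N n0; field.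
rewrite /gamma_seq mulrDl mul1r expCD expC_real lnK ?posrE // rmorph_nat.
have -> : \prod_(k < n.+2) (z + k%:R) =
    z * \prod_(k < n.+2) (z + 1 + k%:R) / (z + n.+2%:R).
  rewrite big_ord_recl addr0 [X in _ = z * X / _]big_ord_recr /=.
  rewrite -addrA nat1r mulrA mulfK //; congr (_ * _).
  by apply: eq_bigr => i _; rewrite /bump /= add1n -addrA nat1r.
have : \prod_(k < n.+2) (z + 1 + k%:R) != 0.
  by apply/prodf_neq0 => k _; rewrite -addrA nat1r.
set P := \prod_(k < n.+2) _ => P0.
move: zn n0; move: (n.+1%:R : R[i]) (n.+2%:R : R[i]) => N1 N2 zn n0.
by field; rewrite P0 z0 n0 zn.
Qed.

Lemma shifted_neq0 w k : w != 0 -> cabs w <= 16^-1 -> w + k%:R != 0 /\ w - k%:R != 0.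
Proof.
move=> w0 w16; case: k => [|k]; first by rewrite addr0 subr0.
have k1 : 1 <= k.+1%:R :> R by rewrite ler1n.
split; rewrite -cabs_eq0 gt_eqF //.
  have := cabs_dist k.+1%:R (- w); rewrite opprK cabsN cabs_nat (addrC w).
  by lra.
by have := cabs_dist k.+1%:R w; rewrite cabs_nat (cabsB w); lra.
Qed.

(** The functional equation leads from w down to w - m in m steps; the factor k = 0 of the product
    carries the pole. *)
Lemma gamma_seq_cvg w m l : w != 0 -> cabs w <= 16^-1 ->
  gamma_quot n w @[n --> \oo] --> (l : R[i]) ->
  gamma_seq n (w - m%:R) @[n --> \oo] --> l / \prod_(k < m.+1) (w - k%:R).
Proof.
move=> w0 w16 ql; elim: m => [|m IH].
  rewrite big_ord1 !subr0.
  apply: (cvgC_eq (cvgCM _ ql (cvg_cst w^-1))) => // n.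
  by rewrite gamma_seq_quot.
have zk k : w - m.+1%:R + k%:R != 0.
  have [km|mk] := leqP k m.+1.
    have -> : w - m.+1%:R + k%:R = w - (m.+1 - k)%:R by rewrite natrB //; ring.
    by have [] := shifted_neq0 (m.+1 - k) w0 w16.
  have -> : w - m.+1%:R + k%:R = w + (k - m.+1)%:R by rewrite natrB ?(ltnW mk) //; ring.
  by have [] := shifted_neq0 (k - m.+1) w0 w16.
apply/cvgC_S.
have zE : w - m.+1%:R + 1 = w - m%:R by rewrite -natr1; ring.
have facE : 1 + (w - m.+1%:R + 1) / n.+1%:R @[n --> \oo] --> (1 : R[i]).
  apply: (@cvgC_cabs _ _ _ _ _ _ (fun n => cabs (w - m.+1%:R + 1) * n.+1%:R^-1)).
    by near=> n; rewrite addrC addKr cabsM cabsV cabs_nat.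
  rewrite -[X in _ --> X](mulr0 (cabs (w - m.+1%:R + 1))).
  exact: (cvgM (cvg_cst _) cvg_harmonic).
have IH1 : gamma_seq n.+1 (w - m%:R) @[n --> \oo] --> l / \prod_(k < m.+1) (w - k%:R).
  exact/(cvgC_S (fun n => gamma_seq n (w - m%:R))).
apply: (cvgC_eq (cvgCM _ IH1 (cvgCM _ facE (cvg_cst (w - m.+1%:R)^-1)))) => [n|] /=.
  by rewrite [RHS]gamma_seq_shift // zE.
by rewrite [in RHS]big_ord_recr /= invfM; ring.
Unshelve. all: by end_near. Qed.

Lemma GammaC_pole w m l : w != 0 -> cabs w <= 16^-1 ->
  gamma_quot n w @[n --> \oo] --> (l : R[i]) ->
  GammaC (w - m%:R) = l / \prod_(k < m.+1) (w - k%:R).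
Proof. by move=> w0 w16 /(@gamma_seq_cvg _ m _ w0 w16) /cvg_lim; apply. Qed.

Lemma cvg_cabs_dnbhs (a : R[i]) (K : R) :
  K * cabs (z - a) @[z --> a^'] --> (0 : R).
Proof.
apply/cvgrPdist_lt => d d0; apply/dnbhsC_cabsP.
have K0 : 0 < `|K| + 1 by rewrite ltr_wpDl.
exists (d / (`|K| + 1)); first by rewrite divr_gt0.
move=> z _; rewrite ltr_pdivlMr // => zd.
rewrite sub0r normrN normrM (ger0_norm (cabs_ge0 _)).
by have := cabs_ge0 (z - a); nra.
Qed.

(** With w = z + m, Gamma(z) is w Gamma(w) divided by the product of the w - k, k <= m, and exp(2 pi
    i z) = exp(2 pi i w). The factor k = 0 cancels the simple zero of exp(2 pi i w) - 1. What
    remains has nonzero limits: 1 for w Gamma(w), 1 for (exp(2 pi i w) - 1) / (2 pi i w), and (-1)^m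
    m! for the product over 1 <= k <= m. *)
Lemma hankel_prefactorE m :
  hankel_prefactor (- m%:R : R[i]) = (-1) ^+ m * m`!%:R / (0 +i* (2 * pi)).
Proof.
rewrite /hankel_prefactor; case: asboolP => [_|[]]; last by exists m.
set tp : R[i] := 0 +i* (2 * pi).
have tp0 : tp != 0 by rewrite eq_complex /= eqxx /= mulf_neq0 // gt_eqF // pi_gt0.
have tpE : (2 * pi)%:C * 'i = tp :> R[i] by rewrite /tp; simpc.
have K0 : 0 < cabs tp by rewrite lt_neqAle eq_sym cabs_eq0 tp0 cabs_ge0.
pose H w := lim (gamma_quot n w @[n --> \oo]).
have HP w : cabs w <= 16^-1 ->
    gamma_quot n w @[n --> \oo] --> H w /\ cabs (H w - 1) <= 34 * cabs w.
  move=> w16; have [l ql l1] := gamma_quot_cvg w16.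
  by have -> : H w = l by exact: cvg_lim.
pose a : R[i] := - m%:R.
have aE z : z = (z - a) - m%:R by rewrite /a; ring.
apply: cvg_lim => //.
have Hlim : H (z - a) @[z --> a^'] --> (1 : R[i]).
  apply: (cvgC_cabs _ _ (@cvg_cabs_dnbhs a 34)).
  apply/dnbhsC_cabsP; exists 16^-1; first by rewrite invr_gt0.
  by move=> z _ /ltW /HP [].
have elim : (expC (tp * (z - a)) - 1) / (tp * (z - a)) @[z --> a^'] --> (1 : R[i]).
  apply: (cvgC_cabs _ _ (@cvg_cabs_dnbhs a (2 * cabs tp))).
  apply/dnbhsC_cabsP; exists (4^-1 / cabs tp); first by rewrite divr_gt0 // invr_gt0.
  move=> z za; rewrite ltr_pdivlMr // => zl.
  have u4 : cabs (tp * (z - a)) <= 4^-1 by rewrite cabsM mulrC ltW.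
  have u0 : tp * (z - a) != 0 by rewrite mulf_neq0 // subr_eq0.
  have := expC_linear u4; set u := tp * (z - a) in u4 u0 *.
  have -> : (expC u - 1) / u - 1 = (expC u - 1 - u) / u by field.
  have u_gt0 : 0 < cabs u by rewrite lt_neqAle eq_sym cabs_eq0 u0 cabs_ge0.
  by rewrite [X in _ -> X <= _]cabsM cabsV ler_pdivrMr // -mulrA -cabsM -/u expr2 mulrA.
have plim : \prod_(k < m) (z - a - k.+1%:R) @[z --> a^'] --> ((-1) ^+ m * m`!%:R : R[i]).
  have -> : (-1) ^+ m * m`!%:R = \prod_(k < m) - k.+1%:R :> R[i].
    rewrite prodrN card_ord; congr (_ * _).
    by rewrite fact_prod natr_prod big_add1 /= big_mkord.
  have subl (x : R[i]) : z - a + x @[z --> a^'] --> x.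
    apply: (cvgC_cabs _ _ (@cvg_cabs_dnbhs a 1)).
    by near=> z; rewrite addrK mul1r.
  elim: (m) => [|j IH].
    under eq_cvg do rewrite big_ord0.
    by rewrite big_ord0; exact: cvg_cst.
  apply: (cvgC_eq (cvgCM _ IH (subl (- j.+1%:R)))) => [z|].
    by rewrite [RHS]big_ord_recr.
  by rewrite [RHS]big_ord_recr.
have flim : \prod_(k < m) (z - a - k.+1%:R) * (H (z - a))^-1 *
    ((expC (tp * (z - a)) - 1) / (tp * (z - a)))^-1 * tp^-1
    @[z --> a^'] --> ((-1) ^+ m * m`!%:R / 1 / 1 / tp : R[i]).
  apply: (cvgCM _ _ (cvg_cst _)); apply: cvgCM; last exact: (cvgV (oner_neq0 _) elim).
  by apply: (cvgCM _ plim); exact: (cvgV (oner_neq0 _) Hlim).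
rewrite !divr1 in flim; apply: cvgC_near_eq flim.
apply/dnbhsC_cabsP; exists 16^-1 => [|z za /ltW z16]; first by rewrite invr_gt0.
have w0 : z - a != 0 by rewrite subr_eq0.
rewrite [in GammaC z](aE z) (@GammaC_pole _ m _ w0 z16 (HP _ z16).1).
rewrite tpE [in expC (tp * z)](aE z); set w := z - a in w0 *.
have -> : expC (tp * (w - m%:R)) = expC (tp * w).
  have -> : tp * (w - m%:R) = tp * w - (0 +i* (2 * pi * m%:R)).
    rewrite mulrBr; congr (_ - _).
    transitivity (tp *+ m); first by rewrite mulr_natr.
    by rewrite /tp im_mulrn mulr_natr.
  by rewrite expCD expCN expC_2pin invr1 mulr1.
rewrite big_ord_recl subr0.
under [in RHS]eq_bigr do rewrite lift0.
rewrite !invfM !invrK.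
set P := \prod_(k < m) _; set E := (_ - 1)^-1; set G := (H w)^-1.
by field; rewrite tp0.
Unshelve. all: by end_near. Qed.

End Gamma.

(** * Integration over the circle *)

Section CircleIntegral.
Variable R : realType.
Implicit Types (g : R -> R[i]) (z : R[i]).

Local Notation mu := (@lebesgue_measure R).
Local Notation D := (`[0, 2 * pi]%classic : set R).

Lemma two_pi_gt0 : 0 < 2 * pi :> R.
Proof. by rewrite mulr_gt0 ?pi_gt0. Qed.

Lemma Rintegral_is_derive (f F : R -> R) (a b : R) : a < b -> continuous f ->
  (forall x : R, is_derive x 1 F (f x)) -> \int[mu]_(x in `[a, b]) f x = F b - F a.
Proof.
move=> ab cf dF; have cF : continuous F.
  move=> x; apply: differentiable_continuous; apply/derivable1_diffP.
  by have [] := dF x.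
rewrite /Rintegral (@continuous_FTC2 _ f F) //.
- by apply: continuous_subspaceT => x; exact: cf.
- split.
  + by move=> x _; have [] := dF x.
  + by apply: cvg_at_right_filter; exact: cF.
  + by apply: cvg_at_left_filter; exact: cF.
- by move=> x _; rewrite derive1E; have [] := dF x.
Qed.

Lemma is_derive_sin_scale (k x : R) : k != 0 ->
  is_derive x 1 (fun t => k^-1 * sin (k * t)) (cos (k * x)).
Proof.
move=> k0; have d1 : is_derive x 1 (fun t => sin (k * t)) (cos (k * x) * k).
  apply: is_derive1_comp.
  rewrite -[X in is_derive _ _ _ X]mulr1; apply: is_deriveZ.
rewrite [cos _](_ : _ = k^-1 *: (cos (k * x) * k)); last first.
  by rewrite /GRing.scale /= mulrCA mulVf ?mulr1.
exact: is_deriveZ.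
Qed.

Lemma is_derive_cos_scale (k x : R) : k != 0 ->
  is_derive x 1 (fun t => - k^-1 * cos (k * t)) (sin (k * x)).
Proof.
move=> k0; have d1 : is_derive x 1 (fun t => cos (k * t)) (- sin (k * x) * k).
  apply: is_derive1_comp.
  rewrite -[X in is_derive _ _ _ X]mulr1; apply: is_deriveZ.
rewrite [sin _](_ : _ = - k^-1 *: (- sin (k * x) * k)); last first.
  by rewrite /GRing.scale /=; field.
exact: is_deriveZ.
Qed.

Lemma continuous_cos_scale (k : R) : continuous (fun t : R => cos (k * t)).
Proof.
by move=> x; apply: continuous_comp; [exact: mulrl_continuous | exact: continuous_cos].
Qed.

Lemma continuous_sin_scale (k : R) : continuous (fun t : R => sin (k * t)).
Proof.
by move=> x; apply: continuous_comp; [exact: mulrl_continuous | exact: continuous_sin].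
Qed.

(** Linearity of the integral requires integrability. This class ensures it and is stable under
    sums, products and the uniform limits of [bmeas_lim], through which the inner iterated integrals
    enter it. *)
Definition bmeas g : Prop :=
  [/\ measurable_fun D (fun x => complex.Re (g x)),
      measurable_fun D (fun x => complex.Im (g x))
    & exists M, forall x, D x -> cabs (g x) <= M].

Lemma measure_D : mu D = (2 * pi)%:E.
Proof. by rewrite lebesgue_measure_itv /= lte_fin two_pi_gt0 oppr0 adde0. Qed.

Lemma bounded_integrable (f : R -> R) M : measurable_fun D f ->
  (forall x, D x -> `|f x| <= M) -> mu.-integrable D (EFin \o f).
Proof.
move=> mf fM; apply: measurable_bounded_integrable => //=.
  by rewrite [X in (X < _)%E]measure_D ltry.
by exists M; split; [exact: num_real | move=> y /ltW My x Dx; exact: le_trans (fM x Dx) My].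
Qed.

Lemma bmeas_integrable g : bmeas g ->
  mu.-integrable D (EFin \o (fun x => complex.Re (g x))) /\
  mu.-integrable D (EFin \o (fun x => complex.Im (g x))).
Proof.
move=> [mR mI [M gM]]; split; apply: (@bounded_integrable _ M) => // x /gM.
- exact/le_trans/Re_le_cabs.
- exact/le_trans/Im_le_cabs.
Qed.

Lemma bmeasD g h : bmeas g -> bmeas h -> bmeas (fun x => g x + h x).
Proof.
move=> [gR gI [M gM]] [hR hI [N hN]]; split.
- rewrite (_ : (fun _ => _) = (fun x => complex.Re (g x) + complex.Re (h x))).
    exact: measurable_funD.
  by apply/funext => x; case: (g x) (h x) => ? ? [].
- rewrite (_ : (fun _ => _) = (fun x => complex.Im (g x) + complex.Im (h x))).
    exact: measurable_funD.
  by apply/funext => x; case: (g x) (h x) => ? ? [].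
- exists (M + N) => x Dx; apply: le_trans (cabsD _ _) _.
  by rewrite lerD ?gM ?hN.
Qed.

Lemma bmeasM g h : bmeas g -> bmeas h -> bmeas (fun x => g x * h x).
Proof.
move=> [gR gI [M gM]] [hR hI [N hN]]; split.
- rewrite (_ : (fun _ => _) = (fun x => complex.Re (g x) * complex.Re (h x)
                                       - complex.Im (g x) * complex.Im (h x))).
    by apply: measurable_funB; exact: measurable_funM.
  by apply/funext => x; case: (g x) (h x) => ? ? [].
- rewrite (_ : (fun _ => _) = (fun x => complex.Re (g x) * complex.Im (h x)
                                       + complex.Im (g x) * complex.Re (h x))).
    by apply: measurable_funD; exact: measurable_funM.
  by apply/funext => x; case: (g x) (h x) => ? ? [].
- exists (M * N) => x Dx; rewrite cabsM.
  by rewrite ler_pM ?cabs_ge0 ?gM ?hN.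
Qed.

Lemma bmeas_cst z : bmeas (fun=> z).
Proof. by split; [exact: measurable_cst|exact: measurable_cst|exists (cabs z)]. Qed.

Lemma bmeas_sum (I : Type) (s : seq I) (P : pred I) (G : I -> R -> R[i]) :
  (forall i, bmeas (G i)) -> bmeas (fun x => \sum_(i <- s | P i) G i x).
Proof.
move=> mG; elim: s => [|i s IH].
  rewrite (_ : (fun _ => _) = fun=> 0); first exact: bmeas_cst.
  by apply/funext => x; rewrite big_nil.
rewrite (_ : (fun _ => _) =
    fun x => (if P i then G i x else 0) + \sum_(j <- s | P j) G j x).
  by apply: bmeasD => //; case: (P i); [exact: mG | exact: bmeas_cst].
by apply/funext => x; rewrite big_cons; case: (P i); rewrite ?add0r.
Qed.

Lemma expC_im (x : R) : expC (0 +i* x) = cos x +i* sin x.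
Proof. by rewrite /expC /= expR0 mul1r. Qed.

Lemma bmeas_expC (k : R) : bmeas (fun x => expC (0 +i* (k * x))).
Proof.
rewrite (_ : (fun _ => _) = fun x => cos (k * x) +i* sin (k * x)); last first.
  by apply/funext => x; rewrite expC_im.
split => /=; last by exists 1 => x _; rewrite -expC_im cabs_expC_im.
- by apply: measurable_funTS; apply: continuous_measurable_fun; exact: continuous_cos_scale.
- by apply: measurable_funTS; apply: continuous_measurable_fun; exact: continuous_sin_scale.
Qed.

Lemma bmeas_lim (G : nat -> R -> R[i]) g (C : R) :
  (forall n, bmeas (G n)) ->
  (forall n x, D x -> cabs (g x - G n x) <= C * 2^-1 ^+ n) -> bmeas g.
Proof.
move=> mG gG.
have cv x : D x -> G n x @[n --> \oo] --> g x.
  move=> Dx; apply: (cvgC_cabs _ _ (half_expr_cvg0 C)).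
  by near=> n; rewrite cabsB; exact: gG.
split.
- apply: (@measurable_fun_cvg _ _ _ _ (fun n x => complex.Re (G n x))).
    by move=> n; have [] := mG n.
  by move=> x Dx; apply: cvgC_Re; exact: cv.
- apply: (@measurable_fun_cvg _ _ _ _ (fun n x => complex.Im (G n x))).
    by move=> n; have [] := mG n.
  by move=> x Dx; apply: cvgC_Im; exact: cv.
- have [_ _ [M GM]] := mG 0%N; exists (C + M) => x Dx.
  rewrite -[g x](subrK (G 0%N x)) (le_trans (cabsD _ _)) // lerD ?GM //.
  by have := gG 0%N x Dx; rewrite expr0 mulr1.
Unshelve. all: by end_near. Qed.

Lemma integralCD g h : bmeas g -> bmeas h ->
  integralC D (fun x => g x + h x) = integralC D g + integralC D h.
Proof.
move=> /bmeas_integrable[gR gI] /bmeas_integrable[hR hI].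
rewrite /integralC; apply/eqP; rewrite eq_complex /=; apply/andP; split; apply/eqP.
- rewrite -RintegralD //; apply: eq_Rintegral => x _.
  by case: (g x) (h x) => ? ? [].
- rewrite -RintegralD //; apply: eq_Rintegral => x _.
  by case: (g x) (h x) => ? ? [].
Qed.

Lemma integralCZ z g : bmeas g ->
  integralC D (fun x => z * g x) = z * integralC D g.
Proof.
case: z => a b mg; have [gR gI] := bmeas_integrable mg.
have ZI (k : R) (f : R -> R) : mu.-integrable D (EFin \o f) ->
    mu.-integrable D (EFin \o (fun x => k * f x)).
  move=> fi; have := @integrableZl _ _ _ mu D (measurable_itv _) k _ fi.
  by apply: eq_integrable => // x _; rewrite /= EFinM.
rewrite /integralC; apply/eqP; rewrite eq_complex /=; apply/andP; split; apply/eqP.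
- rewrite -!RintegralZl // -RintegralB //; try exact: ZI.
  by apply: eq_Rintegral => x _; case: (g x).
- rewrite -!RintegralZl // -RintegralD //; try exact: ZI.
  by apply: eq_Rintegral => x _; case: (g x).
Qed.

Lemma integralC_sum (I : Type) (s : seq I) (P : pred I) (G : I -> R -> R[i]) :
  (forall i, bmeas (G i)) ->
  integralC D (fun x => \sum_(i <- s | P i) G i x) = \sum_(i <- s | P i) integralC D (G i).
Proof.
move=> mG; have integral0 : integralC D (fun=> 0) = 0.
  by rewrite /integralC /= !Rintegral_cst // mul0r.
elim: s => [|i s IH].
  by rewrite big_nil -[RHS]integral0; congr integralC; apply/funext => x; rewrite big_nil.
rewrite big_cons -IH.
have -> : (fun x => \sum_(j <- i :: s | P j) G j x) =
    (fun x => (if P i then G i x else 0) + \sum_(j <- s | P j) G j x).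
  by apply/funext => x; rewrite big_cons; case: (P i); rewrite ?add0r.
rewrite integralCD; [|by case: (P i); [exact: mG|exact: bmeas_cst]|exact: bmeas_sum].
by case: (P i); rewrite ?integral0 ?add0r.
Qed.

(** The real and imaginary parts are bounded separately, which doubles the length 2 pi of the
    interval. *)
Lemma integralC_le g (M : R) : bmeas g -> (forall x, D x -> cabs (g x) <= M) ->
  cabs (integralC D g) <= 4 * pi * M.
Proof.
move=> /bmeas_integrable[gR gI] gM.
have bd (f : R -> R) : mu.-integrable D (EFin \o f) ->
    (forall x, D x -> `|f x| <= M) -> `|\int[mu]_(x in D) f x| <= 2 * pi * M.
  move=> fi fM; apply: le_trans (le_normr_Rintegral _ fi) _ => //.
  apply: (@le_trans _ _ (\int[mu]_(x in D) M)).
    apply: le_Rintegral => //.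
    - exact: (integrable_norm fi).
    - by apply: (@bounded_integrable _ `|M|) => //; exact: measurable_cst.
  by rewrite Rintegral_cst // [X in fine X]measure_D /= mulrC.
apply: le_trans (cabs_le_ReIm _) _.
have -> : 4 * pi * M = 2 * pi * M + 2 * pi * M :> R by ring.
apply: lerD; apply: bd => // x /gM.
- exact/le_trans/Re_le_cabs.
- exact/le_trans/Im_le_cabs.
Qed.

(** The second hypothesis says that k is an integer: the antiderivatives then agree at both ends. *)
Lemma integralC_expC (k : R) : k != 0 -> expC (0 +i* (k * (2 * pi))) = 1 ->
  integralC D (fun x => expC (0 +i* (k * x))) = 0.
Proof.
move=> k0; rewrite expC_im => /eqP.
rewrite eq_complex /= => /andP[/eqP ck /eqP sk].
have -> : (fun x => expC (0 +i* (k * x))) = (fun x => cos (k * x) +i* sin (k * x)).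
  by apply/funext => x; rewrite expC_im.
rewrite /integralC /=; apply/eqP; rewrite eq_complex /=; apply/andP; split; apply/eqP.
- rewrite (Rintegral_is_derive two_pi_gt0 (@continuous_cos_scale k)
    (fun x => is_derive_sin_scale x k0)).
  by rewrite sk !mulr0 sin0 mulr0 subrr.
- rewrite (Rintegral_is_derive two_pi_gt0 (@continuous_sin_scale k)
    (fun x => is_derive_cos_scale x k0)).
  by rewrite ck mulr0 cos0 subrr.
Qed.

End CircleIntegral.

(** * Hankel integrals at non-positive integers *)

Section HankelOperator.
Variable R : realType.
Implicit Types (F G : R[i] -> R[i]) (z : R[i]) (eps : R).

Local Notation D := (`[0, 2 * pi]%classic : set R).
Local Notation tp := ((0 : R) +i* (2 * pi)).

Definition circle eps (theta : R) : R[i] := eps%:C * expC (0 +i* theta).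

Lemma cabs_circle eps theta : 0 < eps -> cabs (circle eps theta) = eps.
Proof. by move=> e0; rewrite cabsM cabs_real cabs_expC_im mulr1 gtr0_norm. Qed.

Lemma circle_neq0 eps theta : 0 < eps -> circle eps theta != 0.
Proof. by move=> e0; rewrite -cabs_eq0 cabs_circle // gt_eqF. Qed.

Lemma circle_expr eps theta n :
  circle eps theta ^+ n = (eps ^+ n)%:C * expC (0 +i* (n%:R * theta)).
Proof.
rewrite exprMn rmorphXn -expC_mulrn im_mulrn; congr (_ * expC (0 +i* _)).
by rewrite mulr_natl.
Qed.

Lemma circle_exprV eps theta n :
  (circle eps theta)^-1 ^+ n = (eps^-1 ^+ n)%:C * expC (0 +i* (- n%:R * theta)).
Proof.
rewrite exprVn circle_expr invfM exprVn fmorphV; congr (_ * _).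
rewrite -expCN; congr expC.
by apply/eqP; rewrite eq_complex /= oppr0 mulNr !eqxx.
Qed.

(* At [s = - m] the two rays of the Hankel contour cancel. *)
Lemma hankel_negint eps m F : 0 < eps ->
  hankel eps (- m%:R) F = integralC D (fun theta =>
    F (circle eps theta) * ('i * (circle eps theta)^-1 ^+ m)).
Proof.
move=> e0; rewrite /hankel.
(* The power t^(s-1) becomes the single-valued t^-(m+1); on the circle dt = i t dtheta turns it into
   i t^-m. *)
have powE z : expC ((- m%:R - 1) * z) = (expC z)^-1 ^+ m.+1.
  have -> : (- m%:R - 1) * z = - (z *+ m.+1) :> R[i].
    by rewrite -[z *+ _]mulr_natr -natr1; ring.
  by rewrite expCN expC_mulrn exprVn.
have rays : integralC `[eps, +oo[ (fun x => F x%:C * expC ((- m%:R - 1) * (ln x)%:C)) =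
    integralC `[eps, +oo[ (fun x => F x%:C * expC ((- m%:R - 1) * (ln x +i* (2 * pi)))).
  congr integralC; apply/funext => x; rewrite !powE; congr (_ * _^-1 ^+ _).
  have -> : ln x +i* (2 * pi) = (ln x)%:C + 0 +i* (2 * pi * 1%:R) :> R[i].
    by rewrite mulr1; simpc.
  by rewrite expCD expC_2pin mulr1.
rewrite -rays addrAC addNr add0r; congr integralC; apply/funext => theta.
rewrite -/(circle eps theta) powE -mulrA; congr (_ * _).
have -> : expC (ln eps +i* theta) = circle eps theta.
  have -> : ln eps +i* theta = (ln eps)%:C + (0 +i* theta) :> R[i] by simpc.
  by rewrite expCD expC_real lnK.
have c0 := circle_neq0 theta e0; rewrite exprSr.
by rewrite mulrCA -[_ * _ * circle _ _]mulrA mulVf // mulr1.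
Qed.

Definition circle_bmeas eps F := bmeas (fun theta => F (circle eps theta)).

Lemma bmeas_circle_expr eps n : bmeas (fun theta => circle eps theta ^+ n).
Proof.
rewrite (_ : (fun _ => _) = fun theta =>
    (eps ^+ n)%:C * expC (0 +i* (n%:R * theta))); last first.
  by apply/funext => theta; exact: circle_expr.
exact: bmeasM (bmeas_cst _) (bmeas_expC _).
Qed.

Lemma bmeas_weight eps m : bmeas (fun theta => 'i * (circle eps theta)^-1 ^+ m).
Proof.
rewrite (_ : (fun _ => _) = fun theta =>
    'i * ((eps^-1 ^+ m)%:C * expC (0 +i* (- m%:R * theta)))); last first.
  by apply/funext => theta; rewrite circle_exprV.
apply: bmeasM (bmeas_cst _) _; exact: bmeasM (bmeas_cst _) (bmeas_expC _).
Qed.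

Lemma circle_bmeas_poly eps (I : finType) (P : pred I) (c : I -> R[i]) (e : I -> nat) :
  circle_bmeas eps (fun z => \sum_(i | P i) c i * z ^+ e i).
Proof.
apply: bmeas_sum => i; exact: bmeasM (bmeas_cst _) (bmeas_circle_expr _ _).
Qed.

Lemma integral_circle_monomial eps n m : 0 < eps ->
  integralC D (fun theta => circle eps theta ^+ n * ('i * (circle eps theta)^-1 ^+ m)) =
  if n == m then tp else 0.
Proof.
move=> e0; case: eqVneq => [->|nm].
  rewrite (_ : (fun _ => _) = fun=> 'i).
    rewrite /integralC /= !Rintegral_cst // [X in fine X]measure_D /=.
    by rewrite mul0r mul1r.
  apply/funext => theta; rewrite mulrCA -exprMn mulfV ?circle_neq0 //.
  by rewrite expr1n mulr1.
have k0 : n%:R - m%:R != 0 :> R by rewrite subr_eq0 eqr_nat.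
rewrite (_ : (fun _ => _) = fun theta => ('i * (eps ^+ n)%:C * (eps^-1 ^+ m)%:C) *
    expC (0 +i* ((n%:R - m%:R) * theta))).
  rewrite integralCZ; last exact: bmeas_expC.
  rewrite integralC_expC ?mulr0 //.
  have -> : 0 +i* ((n%:R - m%:R) * (2 * pi)) =
      (0 +i* (2 * pi * n%:R)) - (0 +i* (2 * pi * m%:R)) :> R[i].
    by apply/eqP; rewrite eq_complex /= subrr eqxx /=; apply/eqP; ring.
  by rewrite expCD expCN !expC_2pin invr1 mulr1.
apply/funext => theta; rewrite circle_expr circle_exprV.
have -> : 0 +i* ((n%:R - m%:R) * theta) =
    (0 +i* (n%:R * theta)) + (0 +i* (- m%:R * theta)) :> R[i].
  by apply/eqP; rewrite eq_complex /= addr0 eqxx /=; apply/eqP; ring.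
by rewrite expCD; ring.
Qed.

(** Several indices may share an exponent: in the iterated integral an index is a whole triangular
    family and [e i] only one of its exponents. *)
Lemma hankel_poly eps m (I : finType) (P : pred I) (c : I -> R[i]) (e : I -> nat) :
  0 < eps ->
  hankel eps (- m%:R) (fun z => \sum_(i | P i) c i * z ^+ e i) =
  tp * \sum_(i | P i && (e i == m)) c i.
Proof.
move=> e0; rewrite hankel_negint //.
rewrite (_ : (fun _ => _) = fun theta => \sum_(i | P i)
    c i * (circle eps theta ^+ e i * ('i * (circle eps theta)^-1 ^+ m))); last first.
  by apply/funext => theta; rewrite mulr_suml; apply: eq_bigr => i _; rewrite mulrA.
have bm i : bmeas (fun theta =>
    circle eps theta ^+ e i * ('i * (circle eps theta)^-1 ^+ m)).
  exact: bmeasM (bmeas_circle_expr _ _) (bmeas_weight _ _).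
rewrite integralC_sum => [|i]; last exact: bmeasM (bmeas_cst _) (bm i).
rewrite mulr_sumr [RHS]big_mkcondr; apply: eq_bigr => i _.
rewrite integralCZ // integral_circle_monomial //.
by case: ifP => _; rewrite ?mulr0 // mulrC.
Qed.

Lemma hankel_dist eps m F G (d : R) : 0 < eps ->
  circle_bmeas eps F -> circle_bmeas eps G ->
  (forall z, cabs z <= eps -> cabs (F z - G z) <= d) ->
  cabs (hankel eps (- m%:R) F - hankel eps (- m%:R) G)
    <= 4 * pi * eps^-1 ^+ m * d.
Proof.
move=> e0 bF bG FG; rewrite !hankel_negint //.
set W := fun theta => 'i * (circle eps theta)^-1 ^+ m.
have bW : bmeas W by exact: bmeas_weight.
have NG : bmeas (fun theta => -1 * (G (circle eps theta) * W theta)).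
  by apply: bmeasM (bmeas_cst _) _; exact: bmeasM.
rewrite -mulN1r -integralCZ; last exact: bmeasM.
rewrite -integralCD //; last exact: bmeasM.
rewrite -mulrA; apply: integralC_le => [|theta _].
  by apply: bmeasD => //; exact: bmeasM.
have -> : F (circle eps theta) * W theta + -1 * (G (circle eps theta) * W theta) =
    (F (circle eps theta) - G (circle eps theta)) * W theta by ring.
have cW : cabs (W theta) = eps^-1 ^+ m.
  rewrite cabsM cabsX cabsV cabs_circle //.
  by rewrite /cabs normc_def /= expr0n expr1n add0r sqrtr1 mul1r.
rewrite cabsM cW mulrC ler_wpM2l ?exprn_ge0 ?invr_ge0 ?(ltW e0) //.
by apply: FG; rewrite cabs_circle.
Qed.

Section Iterated.
Variables (r : nat) (eps : R) (m : 'I_r -> nat).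
Implicit Types (s t : 'rV[R[i]]_r) (ks : seq 'I_r) (k : 'I_r).
Hypothesis eps_gt0 : 0 < eps.

Definition set_coord k z t : 'rV[R[i]]_r := \row_j (if j == k then z else t 0 j).

(** Taken over an arbitrary list so that induction can run on the variables already integrated; at
    [enum 'I_r] it is the iterated integral at s = -m. *)
Definition hankel_fold ks (F : 'rV[R[i]]_r -> R[i]) : 'rV[R[i]]_r -> R[i] :=
  foldr (fun k (G : 'rV[R[i]]_r -> R[i]) t =>
           hankel eps (- (m k)%:R) (fun z => G (set_coord k z t))) F ks.

Definition in_polydisc t := forall j, cabs (t 0 j) <= eps.

Definition mpoly_fun (I : finType) (c : I -> R[i]) (e : I -> 'I_r -> nat) t : R[i] :=
  \sum_i c i * \prod_j t 0 j ^+ e i j.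

Lemma set_coord_polydisc k z t : cabs z <= eps -> in_polydisc t ->
  in_polydisc (set_coord k z t).
Proof. by move=> ze te j; rewrite mxE; case: eqP. Qed.

Section Monomials.
Variables (I : finType) (c : I -> R[i]) (e : I -> 'I_r -> nat).

Lemma prod_set_coord ks k z t i : k \notin ks ->
  \prod_(j | j \notin ks) set_coord k z t 0 j ^+ e i j =
  z ^+ e i k * \prod_(j | j \notin k :: ks) t 0 j ^+ e i j.
Proof.
move=> kks; rewrite (bigD1 k) //= mxE eqxx; congr (_ * _).
rewrite (eq_bigl (fun j => j \notin k :: ks)) => [|j]; last first.
  by rewrite inE negb_or andbC.
by apply: eq_bigr => j; rewrite inE negb_or mxE => /andP[/negbTE ->].
Qed.

(** The formula for [ks] is a hypothesis because this rewriting serves both inside the induction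
    that proves it and later, for measurability. *)
Lemma set_coord_hankel_fold ks k t : k \notin ks -> uniq ks ->
  (forall t, hankel_fold ks (mpoly_fun c e) t =
    tp ^+ size ks * \sum_(i | all (fun k => e i k == m k) ks)
      c i * \prod_(j | j \notin ks) t 0 j ^+ e i j) ->
  (fun z => hankel_fold ks (mpoly_fun c e) (set_coord k z t)) =
  fun z => \sum_(i | all (fun k => e i k == m k) ks)
    (tp ^+ size ks * c i * \prod_(j | j \notin k :: ks) t 0 j ^+ e i j) * z ^+ e i k.
Proof.
move=> kks uks IH; apply/funext => z; rewrite IH mulr_sumr; apply: eq_bigr => i _.
by rewrite prod_set_coord //; ring.
Qed.

Lemma hankel_fold_mpoly ks t : uniq ks ->
  hankel_fold ks (mpoly_fun c e) t =
  tp ^+ size ks * \sum_(i | all (fun k => e i k == m k) ks)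
    c i * \prod_(j | j \notin ks) t 0 j ^+ e i j.
Proof.
elim: ks t => [|k ks IH] t /=; first by rewrite mul1r.
move=> /andP[kks uks]; rewrite set_coord_hankel_fold //; last first.
  by move=> t'; exact: IH.
rewrite hankel_poly // exprS -mulrA; congr (_ * _); rewrite mulr_sumr.
rewrite (eq_bigl (fun i => (e i k == m k) && all (fun k => e i k == m k) ks)).
  by apply: eq_bigr => i _; rewrite mulrA.
by move=> i; rewrite andbC.
Qed.

Lemma circle_bmeas_fold ks k t : k \notin ks -> uniq ks ->
  circle_bmeas eps (fun z => hankel_fold ks (mpoly_fun c e) (set_coord k z t)).
Proof.
move=> kks uks; rewrite set_coord_hankel_fold //; first exact: circle_bmeas_poly.
by move=> t'; exact: hankel_fold_mpoly.
Qed.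

End Monomials.

Variables (I : nat -> finType) (c : forall n, I n -> R[i]).
Variables (e : forall n, I n -> 'I_r -> nat) (F : 'rV[R[i]]_r -> R[i]) (C : R).
Hypothesis F_approx : forall n t, in_polydisc t ->
  cabs (F t - mpoly_fun (@c n) (@e n) t) <= C * 2^-1 ^+ n.

(** Each integration multiplies the error by 4 pi eps^-m. The constant must be uniform in n and t,
    since the inner integral of [F] is measurable in the next variable only as a uniform limit. *)
Lemma hankel_fold_dist ks : uniq ks -> exists K : R, forall n t, in_polydisc t ->
  cabs (hankel_fold ks F t - hankel_fold ks (mpoly_fun (@c n) (@e n)) t)
    <= K * 2^-1 ^+ n.
Proof.
elim: ks => [_|k ks IH /andP[kks uks]]; first by exists C.
have [K HK] := IH uks.
exists (4 * pi * eps^-1 ^+ m k * K) => n t te /=.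
rewrite -mulrA; apply: hankel_dist => //.
- apply: (@bmeas_lim _ (fun n theta => hankel_fold ks (mpoly_fun (@c n) (@e n))
      (set_coord k (circle eps theta) t)) _ K).
    by move=> p; exact: circle_bmeas_fold.
  move=> p theta _; apply: HK; apply: set_coord_polydisc => //.
  by rewrite cabs_circle.
- exact: circle_bmeas_fold.
- by move=> z ze; apply: HK; exact: set_coord_polydisc.
Qed.

(** From N on the integrals of the approximants are all equal to (2 pi i)^r A, and they converge to
    the integral of [F]. *)
Lemma hankel_fold_coeff (A : R[i]) (N : nat) :
  (forall n, (N <= n)%N -> \sum_(i : I n | [forall k, e i k == m k]) c i = A) ->
  hankel_fold (enum 'I_r) F 0 = tp ^+ r * A.
Proof.
move=> cA; have [K HK] := hankel_fold_dist (enum_uniq 'I_r).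
have polydisc0 : in_polydisc 0 by move=> j; rewrite mxE cabs0 ltW.
have cvA : hankel_fold (enum 'I_r) (mpoly_fun (@c n) (@e n)) 0 @[n --> \oo] -->
    hankel_fold (enum 'I_r) F 0.
  apply: (cvgC_cabs _ _ (half_expr_cvg0 K)).
  by near=> n; rewrite cabsB; exact: HK.
apply: (cvgC_unique _ cvA); apply: (cvgC_near_eq _ _ (cvg_cst (tp ^+ r * A))).
exists N => // n /= Nn; rewrite hankel_fold_mpoly ?enum_uniq // size_enum_ord -(cA n Nn).
congr (_ * _); apply: eq_big => [i|i _].
  by apply/forallP/allP => H k *; apply: H; rewrite mem_enum.
by rewrite big_pred0 ?mulr1 // => j; rewrite mem_enum.
Unshelve. all: by end_near. Qed.

End Iterated.

End HankelOperator.

(** * Expansion over triangular families *)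

Section Multinomial.
Variable R : realType.
Local Notation C := R[i].

Lemma fact_neq0 n : n`!%:R != 0 :> C.
Proof. by rewrite pnatr_eq0 -lt0n fact_gt0. Qed.

(** The multinomial theorem read off from the product of the exp(u_l X), which is exp((sum u) X);
    truncating at order K > n keeps the coefficient of X^n. *)
Lemma coef_prod_exp (T : Type) (s : seq T) (u : T -> C) K n : (n < K)%N ->
  (\prod_(l <- s) \sum_(i < K) (u l ^+ i / i`!%:R) *: 'X^i)`_n =
  (\sum_(l <- s) u l) ^+ n / n`!%:R.
Proof.
elim: s n => [|l s IH] n nK.
  by rewrite !big_nil coef1 expr0n; case: n {nK} => [|n]; rewrite ?mul0r // mul1r invr1.
rewrite !big_cons coefM exprDn mulr_suml [RHS](reindex_inj rev_ord_inj).
apply: eq_bigr => i _ /=; have iN : (i <= n)%N by rewrite -ltnS.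
rewrite subSS subKn // IH; last exact: leq_ltn_trans (leq_subr _ _) nK.
rewrite coef_sum (bigD1 (Ordinal (leq_ltn_trans iN nK))) //= big1 => [|k ki].
  rewrite addr0 coefZ coefXn eqxx mulr1.
  rewrite bin_sub // -(bin_fact iN) !natrM -[X in _ = X / _]mulr_natr.
  have f1 := fact_neq0 i; have f2 := fact_neq0 (n - i).
  have b0 : 'C(n, i)%:R != 0 :> C by rewrite pnatr_eq0 -lt0n bin_gt0.
  move: f1 f2 b0; move: (i`!%:R : C) ((n - i)`!%:R : C) ('C(n, i)%:R : C).
  by move=> F1 F2 B f1 f2 b0; field; rewrite f1 f2 b0.
rewrite coefZ coefXn; case: eqP => [ik|]; last by rewrite mulr0.
by case/eqP: ki; apply: val_inj.
Qed.

Lemma multinomial_ffun (T : finType) (u : T -> C) K n : (n < K)%N ->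
  (\sum_l u l) ^+ n / n`!%:R =
  \sum_(f : {ffun T -> 'I_K} | (\sum_l f l == n)%N) \prod_l (u l ^+ f l / (f l)`!%:R).
Proof.
move=> nK; rewrite -(coef_prod_exp _ _ nK) bigA_distr_bigA coef_sum [RHS]big_mkcond.
apply: eq_bigr => f _.
have -> : \prod_l ((u l ^+ f l / (f l)`!%:R) *: 'X^(f l)) =
    (\prod_l (u l ^+ f l / (f l)`!%:R)) *: 'X^(\sum_l f l) :> {poly C}.
  by rewrite scaler_prod -prodrXr.
by rewrite coefZ coefXn eq_sym; case: eqP => _; rewrite ?mulr1 ?mulr0.
Qed.

End Multinomial.

Section TriangularFamilies.
Variables (R : realType) (r : nat).
Local Notation C := R[i].
Implicit Types (g : 'I_r -> nat -> C) (t : 'I_r -> C) (K : nat).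

Definition upper_tri K (nu : 'M['I_K]_r) : bool :=
  [forall d : 'I_r, forall j : 'I_r, (j < d)%N ==> (nu d j == 0 :> nat)].

Definition row_sum K (nu : 'M['I_K]_r) (j : 'I_r) : nat := (\sum_(l < r | (j <= l)%N) nu j l)%N.

Definition col_sum K (nu : 'M['I_K]_r) (j : 'I_r) : nat := (\sum_(d < r | (d <= j)%N) nu d j)%N.

(** Row j of [nu] holds the exponents picked in the j-th linear form: its row sum is the degree in
    that form, and the column sum at l is the resulting exponent of t_l. *)
Definition weight g K (nu : 'M['I_K]_r) : C :=
  \prod_j (g j (row_sum nu j) / (\prod_(d < r | (d <= j)%N) (nu d j)`!)%:R).

Definition rows_lt N K (nu : 'M['I_K]_r) : bool :=
  upper_tri nu && [forall j, row_sum nu j < N]%N.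

Lemma upper_triP K (nu : 'M['I_K]_r) :
  reflect (forall d j : 'I_r, (j < d)%N -> nu d j = 0 :> nat) (upper_tri nu).
Proof.
apply: (iffP 'forall_forallP) => H d j; first by move=> jd; apply/eqP/(implyP (H d j)).
by apply/implyP => /H ->.
Qed.

Lemma row_sumE K (nu : 'M['I_K]_r) j : upper_tri nu -> row_sum nu j = (\sum_l nu j l)%N.
Proof.
move=> /upper_triP tri; rewrite /row_sum [RHS](bigID (fun l : 'I_r => j <= l)%N) /=.
by rewrite [X in (_ + X)%N]big1 ?addn0 // => l; rewrite -ltnNge => /tri.
Qed.

Lemma col_sumE K (nu : 'M['I_K]_r) j : upper_tri nu -> col_sum nu j = (\sum_d nu d j)%N.
Proof.
move=> /upper_triP tri; rewrite /col_sum [RHS](bigID (fun d : 'I_r => d <= j)%N) /=.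
by rewrite [X in (_ + X)%N]big1 ?addn0 // => d; rewrite -ltnNge => /tri.
Qed.

Lemma prod_fact_tri K (nu : 'M['I_K]_r) (j : 'I_r) : upper_tri nu ->
  (\prod_(d < r | (d <= j)%N) (nu d j)`! = \prod_d (nu d j)`!)%N.
Proof.
move=> /upper_triP tri; rewrite [RHS](bigID (fun d : 'I_r => d <= j)%N) /=.
by rewrite [X in (_ * X)%N]big1 ?muln1 // => d; rewrite -ltnNge => /tri ->.
Qed.

Lemma expand_prod g t N K : (N <= K)%N ->
  \prod_j \sum_(n < N) g j n / n`!%:R * (\sum_(l < r | (j <= l)%N) t l) ^+ n =
  \sum_(nu : 'M['I_K]_r | rows_lt N nu) weight g nu * \prod_l t l ^+ col_sum nu l.
Proof.
(* Padding with zeros turns each tail sum into a sum over all variables. A nonzero entry below the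
   diagonal then gives 0 to a positive power, while a zero entry there gives 0^0 = 1. *)
move=> NK; pose u (j l : 'I_r) := if (j <= l)%N then t l else 0.
(* The cut-off merges the sum over degrees n < N and over exponent vectors of degree n into one sum
   over all vectors, to which distributivity applies. *)
pose w (j : 'I_r) (f : {ffun 'I_r -> 'I_K}) : C :=
  if (\sum_l f l < N)%N then g j (\sum_l f l)%N * \prod_l (u j l ^+ f l / (f l)`!%:R)
  else 0.
have rowE j : \sum_(n < N) g j n / n`!%:R * (\sum_(l < r | (j <= l)%N) t l) ^+ n =
    \sum_f w j f.
  rewrite /w -big_mkcond.
  rewrite (eq_bigr (fun n : 'I_N => \sum_(f : {ffun 'I_r -> 'I_K} | (\sum_l f l == n)%N)
      g j n * \prod_l (u j l ^+ f l / (f l)`!%:R))) => [|n _]; last first.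
    rewrite -mulr_sumr -multinomial_ffun; last exact: leq_trans NK.
    rewrite mulrAC mulrA; congr (_ * _ ^+ _ / _).
    by rewrite big_mkcond; apply: eq_bigr.
  rewrite (exchange_big_dep (fun f : {ffun 'I_r -> 'I_K} => \sum_l f l < N)%N) /=; last first.
    by move=> n f _ /eqP ->.
  apply: eq_bigr => f fN; rewrite (big_pred1 (Ordinal fN)) //.
rewrite (eq_bigr _ (fun j _ => rowE j)) bigA_distr_bigA.
rewrite (reindex (fun nu : 'M['I_K]_r => [ffun j => [ffun l => nu j l]])) /=; last first.
  exists (fun f : {ffun 'I_r -> {ffun 'I_r -> 'I_K}} => \matrix_(j, l) f j l).
    by move=> nu _; apply/matrixP => j l; rewrite mxE !ffunE.
  by move=> f _; apply/ffunP => j; apply/ffunP => l; rewrite !ffunE mxE.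
rewrite [RHS]big_mkcond; apply: eq_bigr => nu _.
have wE j : w j ([ffun j => [ffun l => nu j l]] j) =
    if (\sum_l nu j l < N)%N
    then g j (\sum_l nu j l)%N * \prod_l (u j l ^+ nu j l / (nu j l)`!%:R) else 0.
  rewrite /w ffunE.
  have -> : (\sum_l [ffun l => nu j l] l = \sum_l nu j l)%N.
    by apply: eq_bigr => l _; rewrite ffunE.
  by congr (if _ then _ * _ else _); apply: eq_bigr => l _; rewrite ffunE.
rewrite (eq_bigr _ (fun j _ => wE j)).
rewrite /rows_lt; case: (boolP (upper_tri nu)) => /= [tri|]; last first.
  rewrite negb_forall => /existsP[d]; rewrite negb_forall => /existsP[j].
  rewrite negb_imply => /andP[jd nu0]; rewrite (bigD1 d) //=.
  have dj : (d <= j)%N = false by rewrite leqNgt jd.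
  rewrite [\prod_(l < r) (u d l ^+ _ / _)](bigD1 j) //= /u dj expr0n (negbTE nu0) !mul0r mulr0.
  by case: ifP => _; rewrite mul0r.
case: (boolP [forall j, _]) => [/forallP rN|]; last first.
  rewrite negb_forall => /existsP[j]; rewrite row_sumE // => /negbTE jN.
  by rewrite (bigD1 j) //= jN mul0r.
rewrite (eq_bigr (fun j => g j (row_sum nu j) * \prod_l (u j l ^+ nu j l / (nu j l)`!%:R))).
  rewrite big_split /weight /= big_split /= -mulrA; congr (_ * _).
  rewrite exchange_big -big_split; apply: eq_bigr => l _ /=.
  rewrite prod_fact_tri // col_sumE // natr_prod -prodfV -prodrXr -big_split /=.
  apply: eq_bigr => j _; rewrite mulrC; congr (_ * _); rewrite /u.
  by case: leqP => // /(upper_triP _ tri) ->.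
by move=> j _; rewrite -row_sumE // rN.
Qed.

Definition family (k : 'I_r -> nat) K (nu : 'M['I_K]_r) : bool :=
  upper_tri nu && [forall j, col_sum nu j == k j].

Lemma family_entry (k : 'I_r -> nat) K (nu : 'M['I_K]_r) d j :
  family k nu -> (nu d j <= k j)%N.
Proof.
move=> /andP[tri /forallP/(_ j)/eqP <-]; rewrite col_sumE //.
by rewrite (bigD1 d) //= leq_addr.
Qed.

Lemma family_row_sum (k : 'I_r -> nat) K (nu : 'M['I_K]_r) j :
  family k nu -> (row_sum nu j <= \sum_l k l)%N.
Proof.
move=> fam; rewrite row_sumE; last by case/andP: fam.
by apply: leq_sum => l _; exact: family_entry.
Qed.

(** Entries never exceed k_j, so families of several multi-indices can be moved to one matrix
    type. *)
Lemma sum_family_widen g (k : 'I_r -> nat) K L : (forall j, k j <= K)%N -> (K <= L)%N ->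
  \sum_(nu : 'M['I_K.+1]_r | family k nu) weight g nu =
  \sum_(nu : 'M['I_L.+1]_r | family k nu) weight g nu.
Proof.
move=> kK KL; have KL' : (K.+1 <= L.+1)%N by [].
pose up (nu : 'M['I_K.+1]_r) : 'M['I_L.+1]_r := map_mx (widen_ord KL') nu.
pose down (nu : 'M['I_L.+1]_r) : 'M['I_K.+1]_r := map_mx (fun i : 'I_L.+1 => inord i) nu.
have upE nu d j : up nu d j = nu d j :> nat by rewrite mxE.
rewrite [RHS](reindex_onto up down) => [|nu fam]; last first.
  apply/matrixP => d j; apply: val_inj; rewrite !mxE /= inordK // ltnS.
  exact: leq_trans (family_entry d j fam) _.
have upK nu : down (up nu) = nu.
  by apply/matrixP => d j; apply: val_inj; rewrite !mxE /= inordK.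
apply: eq_big => [nu|nu _].
  rewrite upK eqxx andbT; congr (_ && _).
    by apply: eq_forallb => d; apply: eq_forallb => j; rewrite upE.
  apply: eq_forallb => j; congr (_ == _); apply: eq_bigr => d _; exact/esym/upE.
apply: eq_bigr => j _; congr (g j _ / _%:R).
  by apply: eq_bigr => l _; rewrite upE.
by apply: eq_bigr => d _; rewrite upE.
Qed.

End TriangularFamilies.

(** * Unconditional convergence over multi-indices *)

Section ProductEstimates.
Variable R : realType.
Local Notation C := R[i].

(** Factors are exchanged one at a time, by f F - g G = f (F - G) + (f - g) G. *)
Lemma prod_dist (T : Type) (s : seq T) (f g : T -> C) (M d : R) : 1 <= M ->
  (forall i, cabs (f i) <= M) -> (forall i, cabs (g i) <= M) ->
  (forall i, cabs (f i - g i) <= d) ->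
  cabs (\prod_(i <- s) f i - \prod_(i <- s) g i) <= (size s)%:R * M ^+ size s * d.
Proof.
move=> M1 fM gM fgd; have M0 : 0 <= M by exact: le_trans M1.
elim: s => [|i s IH]; first by rewrite !big_nil subrr cabs0 mul0r mul0r.
have d0 : 0 <= d by exact: le_trans (cabs_ge0 _) (fgd i).
have gs : cabs (\prod_(j <- s) g j) <= M ^+ size s.
  elim: (s) => [|j s' IHs]; first by rewrite big_nil cabs1.
  by rewrite big_cons cabsM exprS ler_pM ?cabs_ge0.
rewrite !big_cons /= -natr1 exprS.
set F := \prod_(j <- s) f j in IH *; set G := \prod_(j <- s) g j in IH gs *.
have -> : f i * F - g i * G = f i * (F - G) + (f i - g i) * G by ring.
apply: le_trans (cabsD _ _) _; rewrite !cabsM.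
have h1 := ler_pM (cabs_ge0 _) (cabs_ge0 _) (fM i) IH.
have h2 := ler_pM (cabs_ge0 _) (cabs_ge0 _) (fgd i) gs.
apply: le_trans (lerD h1 h2) _.
have h3 : d * M ^+ size s <= M * M ^+ size s * d.
  by rewrite mulrC ler_wpM2r // ler_peMl ?exprn_ge0.
by rewrite mulrDl mul1r mulrDl -!mulrA mulrCA lerD2l mulrA.
Qed.

(** The constant of [prod_dist]: each sum is at most 2 A, each truncation at most 4 A, each
    truncation error at most 2 A 4^-N; the added 1 makes the common bound at least 1. *)
Definition trunc_bound (r : nat) (A : R) : R := r%:R * (4 * A + 1) ^+ r * (2 * A).

Lemma trunc_prod (r : nat) (u : 'I_r -> nat -> C) (L : 'I_r -> C) (A : R) N :
  0 <= A ->
  (forall j n, cabs (u j n) <= A * 4^-1 ^+ n) ->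
  (forall j, \sum_(i < n) u j i @[n --> \oo] --> L j) ->
  cabs (\prod_j L j - \prod_j \sum_(i < N) u j i) <= trunc_bound r A * 2^-1 ^+ N.
Proof.
move=> A0 uA uL.
have q4 : 0 <= (4^-1 : R) <= 2^-1 by apply/andP; split; lra.
have tail j n : cabs (L j - \sum_(i < n) u j i) <= 2 * A * 4^-1 ^+ n.
  exact: geo_le q4 (uA j) (uL j).
have L2 j : cabs (L j) <= 2 * A.
  by have := tail j 0%N; rewrite big_ord0 subr0 expr0 mulr1.
have tail1 j n : cabs (L j - \sum_(i < n) u j i) <= 2 * A.
  apply: le_trans (tail j n) _; rewrite ler_piMr ?mulr_ge0 // exprn_ile1 //.
  by rewrite invf_le1 ?ler1n.
have le4 j n : cabs (\sum_(i < n) u j i) <= 4 * A + 1.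
  have := tail1 j n; rewrite cabsB; have := cabs_dist (\sum_(i < n) u j i) (L j).
  by have := L2 j; lra.
have := @prod_dist _ (index_enum 'I_r) L (fun j => \sum_(i < N) u j i) (4 * A + 1)
  (2 * A * 4^-1 ^+ N) _ _ (fun j => le4 j N) (fun j => tail j N).
have -> : size (index_enum 'I_r) = r by rewrite -[RHS]card_ord cardT enumT.
move=> /(_ _ _)/le_trans; apply; rewrite ?lerDr ?mulr_ge0 //.
  by move=> j; have := L2 j; lra.
rewrite /trunc_bound -!mulrA !ler_wpM2l ?exprn_ge0 ?addr_ge0 ?mulr_ge0 //.
by rewrite lerXn2r ?nnegrE ?invr_ge0 // lef_pV2 ?posrE ?ler_nat.
Qed.

End ProductEstimates.

Section FamilySum.
Variables (R : realType) (r : nat).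
Local Notation C := R[i].
Variables (g : 'I_r -> nat -> C) (t : 'I_r -> C).

(** The coefficient of t^m in the product over j of the series with terms [g j n / n!] times the
    n-th power of t_j + ... + t_r. *)
Definition family_coeff (m : {ffun 'I_r -> nat}) : C :=
  \sum_(nu : 'M['I_(\max_(j < r) m j).+1]_r | family m nu) weight g nu.

Definition monomial (m : 'I_r -> nat) : C := \prod_l t l ^+ m l.

Definition col_fun K (nu : 'M['I_K]_r) : {ffun 'I_r -> nat} := [ffun l => col_sum nu l].

Lemma family_col_fun (m : {ffun 'I_r -> nat}) K (nu : 'M['I_K]_r) :
  family m nu = upper_tri nu && (col_fun nu == m).
Proof.
rewrite /family; congr (_ && _); apply/forallP/eqP => [H|<- j]; last by rewrite ffunE.
by apply/ffunP => j; rewrite ffunE; apply/eqP.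
Qed.

(** A common bound K puts the families of all m in [A] into one matrix type, where each is counted
    once, at the m formed by its column sums. *)
Lemma sum_family_coeff (A : seq {ffun 'I_r -> nat}) K : uniq A ->
  (forall m, m \in A -> forall j, m j <= K)%N ->
  \sum_(m <- A) family_coeff m * monomial m =
  \sum_(nu : 'M['I_K.+1]_r | upper_tri nu && (col_fun nu \in A))
    weight g nu * monomial (col_sum nu).
Proof.
move=> uA AK.
rewrite big_seq (eq_bigr (fun m : {ffun 'I_r -> nat} => \sum_(nu : 'M['I_K.+1]_r | family m nu)
    weight g nu * monomial (col_sum nu))) => [|m mA]; last first.
  rewrite /family_coeff (@sum_family_widen _ _ _ _ _ K); last 2 first.
  - by move=> j; exact: leq_bigmax.
  - by apply/bigmax_leqP => j _; exact: AK.
  rewrite mulr_suml; apply: eq_bigr => nu /andP[_ /forallP fam]; congr (_ * _).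
  by apply: eq_bigr => l _; rewrite (eqP (fam l)).
rewrite -big_seq (exchange_big_dep (fun nu => upper_tri nu)) /=; last first.
  by move=> m nu _ /andP[].
rewrite big_mkcondr; apply: eq_bigr => nu tri.
rewrite (eq_bigl (pred1 (col_fun nu))) => [|m]; last first.
  by rewrite /= family_col_fun tri eq_sym.
case: ifP => nuA; first by rewrite -big_filter filter_pred1_uniq // big_seq1.
rewrite big1_seq // => m /andP[/eqP -> mA].
by rewrite mA in nuA.
Qed.

(** The moduli stand inside the linear form because every monomial of its expansion has to be summed
    absolutely. *)
Hypothesis g_le : forall j n,
  cabs (g j n / n`!%:R) * (\sum_(l < r | (j <= l)%N) cabs (t l)) ^+ n <= 4^-1 ^+ n.

Let term K (nu : 'M['I_K]_r) := weight g nu * monomial (col_sum nu).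

(** [expand_prod] for the moduli of g and t; the cast is there because that expansion is over the
    complex numbers. *)
Lemma sum_rows_abs N K : (N <= K)%N ->
  (\sum_(nu : 'M['I_K]_r | rows_lt N nu) cabs (term nu))%:C =
  \prod_j \sum_(n < N) (cabs (g j n))%:C / n`!%:R *
    (\sum_(l < r | (j <= l)%N) (cabs (t l))%:C) ^+ n.
Proof.
move=> NK; rewrite (expand_prod (fun j n => (cabs (g j n))%:C) (fun l => (cabs (t l))%:C) NK).
rewrite rmorph_sum; apply: eq_bigr => nu _ /=.
rewrite cabsM rmorphM /weight /monomial !cabs_prod !rmorph_prod; congr (_ * _).
  by apply: eq_bigr => j _; rewrite cabsM cabsV cabs_nat fmorph_div rmorph_nat.
by apply: eq_bigr => l _; rewrite cabsX rmorphXn.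
Qed.

(** The sum is the difference of the products of moduli truncated at K and at N; both lie within the
    truncation bound of the same limit. *)
Lemma sum_rows_abs_diff N K : (N <= K)%N ->
  \sum_(nu : 'M['I_K]_r | rows_lt K nu && ~~ rows_lt N nu) cabs (term nu)
    <= 2 * trunc_bound r 1 * 2^-1 ^+ N.
Proof.
move=> NK.
have rowsNK (nu : 'M['I_K]_r) : rows_lt N nu -> rows_lt K nu.
  move=> /andP[tri /forallP rN]; rewrite /rows_lt tri; apply/forallP => j.
  exact: leq_trans (rN j) NK.
pose u j n : C := (cabs (g j n))%:C / n`!%:R *
    (\sum_(l < r | (j <= l)%N) (cabs (t l))%:C) ^+ n.
have u4 j n : cabs (u j n) <= 1 * 4^-1 ^+ n.
  rewrite mul1r; apply: le_trans (g_le j n).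
  rewrite /u cabsM cabsX !cabsM cabs_real (ger0_norm (cabs_ge0 _)).
  by rewrite -rmorph_sum cabs_real ger0_norm ?sumr_ge0 // => l _; exact: cabs_ge0.
have q4 : 0 <= (4^-1 : R) <= 2^-1 by apply/andP; split; lra.
have [L uL] := choice (fun j => geo_cvg q4 (u4 j)).
have dN n := trunc_prod n ler01 u4 uL.
have split : \sum_(nu : 'M['I_K]_r | rows_lt K nu) cabs (term nu) =
    \sum_(nu : 'M['I_K]_r | rows_lt N nu) cabs (term nu) +
    \sum_(nu : 'M['I_K]_r | rows_lt K nu && ~~ rows_lt N nu) cabs (term nu).
  rewrite (bigID (fun nu => rows_lt N nu)) /=; congr (_ + _); apply: eq_bigl => nu.
  by apply/andP/idP => [[] //|H]; split=> //; exact: rowsNK.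
have S0 : 0 <= \sum_(nu : 'M['I_K]_r | rows_lt K nu && ~~ rows_lt N nu) cabs (term nu).
  by apply: sumr_ge0 => nu _; exact: cabs_ge0.
have := congr1 (fun x : R => x%:C) split; rewrite rmorphD /= !sum_rows_abs //.
rewrite -/(\prod_j \sum_(n < K) u j n) -/(\prod_j \sum_(n < N) u j n).
set S := \sum_(nu | _) _ in S0 *; set QK := \prod_j _; set QN := \prod_j _ => QE.
have SE : S%:C = (\prod_j L j - QN) - (\prod_j L j - QK) by rewrite QE; ring.
rewrite -(ger0_norm S0) -cabs_real SE; apply: le_trans (cabsD _ _) _; rewrite cabsN.
apply: le_trans (lerD (dN N) (dN K)) _.
have : trunc_bound r 1 * 2^-1 ^+ K <= trunc_bound r 1 * 2^-1 ^+ N :> R.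
  rewrite ler_wpM2l ?/trunc_bound ?mulr_ge0 ?exprn_ge0 ?addr_ge0 //.
  by apply: ler_wiXn2l => //; rewrite ?invr_ge0 ?invf_le1 ?ler1n.
by lra.
Qed.

(* Once the index set contains all [m] with entries at most [r N], the partial sum
   differs from the product of the truncations at order [N] by terms that have
   some row sum at least [N]. *)
Lemma family_sum_cvg (L : 'I_r -> C) :
  (forall j, \sum_(n < N) g j n / n`!%:R * (\sum_(l < r | (j <= l)%N) t l) ^+ n
     @[N --> \oo] --> L j) ->
  partial_sum (fun m : {ffun 'I_r -> nat} => family_coeff m * monomial m)
    @ totally --> \prod_j L j.
Proof.
move=> gL; have FF := @totally_filter {ffun 'I_r -> nat}.
apply/cvgC_cabsP => e e0.
have u4 j n : cabs (g j n / n`!%:R * (\sum_(l < r | (j <= l)%N) t l) ^+ n) <=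
    1 * 4^-1 ^+ n.
  rewrite mul1r; apply: le_trans (g_le j n); rewrite cabsM cabsX.
  rewrite ler_wpM2l ?cabs_ge0 // lerXn2r ?nnegrE ?cabs_ge0 ?sumr_ge0 ?cabs_sum //.
  by move=> *; exact: cabs_ge0.
have dN n := trunc_prod n ler01 u4 gL.
(* One bound pays for the truncated product, two for the families with a long row. *)
have [N _ HN] : \forall N \near \oo, 3 * trunc_bound r 1 * 2^-1 ^+ N < e.
  move: (half_expr_cvg0 (3 * trunc_bound r (1 : R))) => /cvgrPdist_lt /(_ e e0).
  apply: filterS => n; rewrite sub0r normrN; apply: le_lt_trans; exact: ler_norm.
have {}HN := HN N (leqnn N).
(* If all row sums are below N, so are all entries, and a column of r entries sums to at most r
   N. *)
pose box : seq {ffun 'I_r -> nat} :=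
  map (fun f : {ffun 'I_r -> 'I_(r * N).+1} => [ffun j => val (f j)]) (enum predT).
exists [fset m in box]%fset => //= A boxA.
(* K dominates N and the total degree of each m in [A], hence all entries and row sums of the
   families that occur. *)
pose K := (N + \sum_(m <- A) \sum_l m l)%N.
have AK (m : {ffun 'I_r -> nat}) : m \in A -> (\sum_l m l <= K)%N.
  move=> mA; rewrite /K (big_rem m) //= addnCA; exact: leq_addr.
have AKj (m : {ffun 'I_r -> nat}) : m \in A -> forall j, (m j <= K)%N.
  by move=> mA j; apply: leq_trans (AK m mA); rewrite (bigD1 j) //= leq_addr.
rewrite /partial_sum.
rewrite -(big_seq_fsetE _ A xpredT (fun m => family_coeff m * monomial m)) /=.
rewrite (sum_family_coeff (fset_uniq A) AKj).
have NK : (N <= K.+1)%N by rewrite leqW // leq_addr.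
have rowsA (nu : 'M['I_K.+1]_r) : rows_lt N nu -> upper_tri nu && (col_fun nu \in A).
  move=> /andP[tri /forallP rN]; rewrite tri; apply: (fsubsetP boxA).
  rewrite !inE; apply/mapP.
  exists [ffun j => inord (col_sum nu j)]; first by rewrite mem_enum.
  apply/ffunP => j; rewrite !ffunE /= inordK // ltnS col_sumE //.
  have -> : (r * N = \sum_(d < r) N)%N by rewrite sum_nat_const card_ord.
  apply: leq_sum => d _; apply: leq_trans (ltnW (rN d)); rewrite row_sumE //.
  by rewrite (bigD1 j) //= leq_addr.
have rowsK (nu : 'M['I_K.+1]_r) : upper_tri nu && (col_fun nu \in A) -> rows_lt K.+1 nu.
  move=> /andP[tri nuA]; rewrite /rows_lt tri; apply/forallP => j; rewrite ltnS.
  apply: leq_trans (AK _ nuA); apply: (@family_row_sum _ (col_fun nu)).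
  by rewrite family_col_fun tri eqxx.
rewrite (bigID (fun nu => rows_lt N nu)) /=.
rewrite (eq_bigl (fun nu : 'M['I_K.+1]_r => rows_lt N nu)) => [|nu]; last first.
  by apply/andP/idP => [[] //|H]; split=> //; exact: rowsA.
have tail : cabs (\sum_(nu : 'M['I_K.+1]_r |
    (upper_tri nu && (col_fun nu \in A)) && ~~ rows_lt N nu) term nu) <=
    2 * trunc_bound r 1 * 2^-1 ^+ N.
  apply: le_trans (sum_rows_abs_diff NK); apply: le_trans (cabs_sum _ _ _) _.
  rewrite big_mkcond [leRHS]big_mkcond; apply: ler_sum => nu _.
  case: ifP => [/andP[/rowsK -> ->] //|_].
  by case: ifP => _; rewrite ?cabs_ge0.
have := dN N; rewrite (expand_prod g t NK) -/(monomial _).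
set S := \sum_(nu | rows_lt N nu) _ => head.
rewrite cabsB opprD addrA; apply: le_lt_trans (cabsD _ _) _; rewrite cabsN.
apply: le_lt_trans HN.
apply: le_trans (lerD head tail) _; lra.
Qed.

End FamilySum.

(** * Values of the desingularized zeta function *)

Section ZetaDes.
Variables (R : realType) (r : nat) (gamma : 'rV[R[i]]_r).
Local Notation C := R[i].
Local Notation tp := ((0 : R) +i* (2 * pi)).
Implicit Types (t : 'rV[C]_r) (m : {ffun 'I_r -> nat}) (c eps : R).

(** How small the contour must be in terms of gamma: it bounds every x_j by 1/8, in the form with
    moduli that absolute convergence requires. *)
Definition radius_ok eps :=
  forall t j, (forall l, cabs (t 0 l) <= eps) ->
    cabs (gamma 0 j) * (\sum_(l < r | (j <= l)%N) cabs (t 0 l)) <= 8^-1.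

Lemma near_radius_ok : \forall eps \near (0 : R)^'+, radius_ok eps.
Proof.
pose G := \sum_j cabs (gamma 0 j).
have G0 : 0 <= G by apply: sumr_ge0 => *; exact: cabs_ge0.
pose M := 8 * (G * r%:R + 1).
have M0 : 0 < M by rewrite mulr_gt0 // ltr_wpDl // mulr_ge0.
near=> eps => t j te.
have eps0 : 0 < eps by near: eps; exact: nbhs_right_gt.
have epsM : eps < M^-1 by near: eps; apply: nbhs_right_lt; rewrite invr_gt0.
have gG : cabs (gamma 0 j) <= G.
  by rewrite /G (bigD1 j) //= lerDl sumr_ge0 // => *; exact: cabs_ge0.
have st : \sum_(l < r | (j <= l)%N) cabs (t 0 l) <= r%:R * eps.
  apply: (@le_trans _ _ (\sum_(l < r) eps)).
    by rewrite big_mkcond; apply: ler_sum => l _; case: ifP => // _; exact: ltW.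
  by rewrite sumr_const card_ord mulr_natl.
have st0 : 0 <= \sum_(l < r | (j <= l)%N) cabs (t 0 l).
  by apply: sumr_ge0 => *; exact: cabs_ge0.
apply: le_trans (ler_pM (cabs_ge0 _) st0 gG st) _.
move: epsM; rewrite -div1r ltr_pdivlMr // => /ltW.
by rewrite /M; lra.
Unshelve. all: by end_near. Qed.

Lemma cabs_tail_form eps t j : radius_ok eps -> (forall l, cabs (t 0 l) <= eps) ->
  cabs (tail_form gamma t j) <= 8^-1.
Proof.
move=> ok te; apply: le_trans (ok t j te); rewrite cabsM.
by rewrite ler_wpM2l ?cabs_ge0 ?cabs_sum.
Qed.

(** The factorial undoes the division by n! in the multinomial expansion, so that the n-th term
    becomes a_n x_j^n. *)
Definition coeff_weight (a : nat -> C) (j : 'I_r) (n : nat) : C :=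
  a n * gamma 0 j ^+ n * n`!%:R.

Lemma coeff_weightE a t j n :
  coeff_weight a j n / n`!%:R * (\sum_(l < r | (j <= l)%N) t 0 l) ^+ n =
  a n * tail_form gamma t j ^+ n.
Proof. by rewrite /coeff_weight mulfK ?fact_neq0 // -mulrA -exprMn. Qed.

Lemma cabs_geo (a : nat -> C) (A : R) (x : C) n : cabs x <= 8^-1 ->
  (forall n, cabs (a n) <= A * 2 ^+ n) -> cabs (a n * x ^+ n) <= A * 4^-1 ^+ n.
Proof.
move=> x8 aA; have -> : A * 4^-1 ^+ n = A * 2 ^+ n * 8^-1 ^+ n :> R.
  by rewrite -mulrA -exprMn; congr (_ * _ ^+ _); field.
rewrite cabsM cabsX ler_pM ?cabs_ge0 ?exprn_ge0 ?cabs_ge0 //.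
by rewrite lerXn2r // nnegrE ?cabs_ge0 // invr_ge0.
Qed.

Lemma hankel_iter_Htilde eps c m : 0 < eps -> radius_ok eps -> 2^-1 <= c <= 2 ->
  hankel_iter eps (\row_j - (m j)%:R) (Htilde gamma c) =
  tp ^+ r * family_coeff (coeff_weight (fun n => (h_coeff c n)%:C)) m.
Proof.
move=> eps0 ok c12; set g := coeff_weight _.
have -> : hankel_iter eps (\row_j - (m j)%:R) (Htilde gamma c) =
    hankel_fold eps m (enum 'I_r) (Htilde gamma c) 0.
  rewrite /hankel_iter /hankel_fold; congr (foldr _ _ _ _).
  by apply/funext => k; apply/funext => G; apply/funext => t; rewrite mxE.
(* The n-th approximant is the expanded product of the truncations at order n; 3 is the constant of
   [h_coeff_le]. A family for m has row sums at most the sum of the m_l, so beyond that order the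
   coefficient of t^m is complete. *)
apply: (@hankel_fold_coeff _ _ _ _ eps0 (fun n => 'M['I_n.+1]_r : finType)
  (fun n nu => if rows_lt n nu then weight g nu else 0)
  (fun n nu l => col_sum nu l) _ (trunc_bound r 3) _ _ (\sum_l m l).+1).
- move=> n t te; rewrite /mpoly_fun.
  have -> : \sum_(nu : 'M['I_n.+1]_r)
      (if rows_lt n nu then weight g nu else 0) * \prod_j t 0 j ^+ col_sum nu j =
      \prod_j \sum_(i < n) (h_coeff c i)%:C * tail_form gamma t j ^+ i.
    rewrite (eq_bigr (fun j => \sum_(i < n) g j i / i`!%:R *
        (\sum_(l < r | (j <= l)%N) t 0 l) ^+ i)) => [|j _]; last first.
      by apply: eq_bigr => i _; rewrite coeff_weightE.
    rewrite (expand_prod g (fun l => t 0 l) (leqnSn n)) [RHS]big_mkcond.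
    by apply: eq_bigr => nu _; case: ifP => _; rewrite ?mul0r.
  rewrite /Htilde; apply: (@trunc_prod _ _ (fun j i => (h_coeff c i)%:C *
    tail_form gamma t j ^+ i)) => // [j i|j].
    apply: (@cabs_geo (fun n => (h_coeff c n)%:C)); first exact: cabs_tail_form ok te.
    by move=> k; apply: h_coeff_le; lra.
  by apply: extend0_h_series => //; exact: cabs_tail_form ok te.
- move=> n mn; rewrite /family_coeff.
  rewrite (@sum_family_widen _ _ _ _ _ n); last 2 first.
  + by move=> j; exact: leq_bigmax.
  + apply/bigmax_leqP => j _; apply: leq_trans (ltnW mn).
    by rewrite (bigD1 j) //= leq_addr.
  rewrite big_mkcond [RHS]big_mkcond; apply: eq_bigr => nu _.
  have [fam|nfam] := boolP (family m nu).
    have rows : rows_lt n nu.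
      move: (fam) => /andP[tri _]; rewrite /rows_lt tri; apply/forallP => j.
      exact: leq_ltn_trans (family_row_sum j fam) mn.
    by rewrite rows; case/andP: fam => _ ->.
  case: ifP => // cs; case: ifP => // /andP[tri _].
  by move: nfam; rewrite /family tri cs.
Qed.

(* [h_coeff c n / (1 - c)] *)
Definition h_quot c n : R := bern R n.+1 * \sum_(i < n.+1) c ^+ i.

Lemma h_quot_cvg n : h_quot c n @[c --> (1 : R)^'] --> phi_coeff R n.
Proof.
have cvX k : c ^+ k @[c --> (1 : R)^'] --> (1 : R).
  have H : c ^+ k @[c --> (1 : R)] --> (1 : R) ^+ k by exact: exprn_continuous.
  by rewrite expr1n in H; exact: cvg_within_filter.
suff cvS k : \sum_(i < k) c ^+ i @[c --> (1 : R)^'] --> (k%:R : R).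
  by rewrite /phi_coeff mulrC; apply: (cvgM (cvg_cst _)); exact: cvS.
elim: k => [|k IH].
  by under eq_cvg do rewrite big_ord0; exact: cvg_cst.
under eq_cvg do rewrite big_ord_recr /=.
by rewrite -natr1; exact: (cvgD IH (cvX k)).
Qed.

Definition zeta_coeff m : C := family_coeff (coeff_weight (fun n => (phi_coeff R n)%:C)) m.

(** The powers of 2 pi i from the integral and the prefactors cancel. After (1-c)^r is taken out, a
    finite sum with coefficients polynomial in c is left, whose limit is termwise. *)
Lemma zeta_des_negint eps m : 0 < eps -> radius_ok eps ->
  zeta_des eps gamma (\row_j - (m j)%:R) =
  (\prod_(l < r) ((-1) ^+ m l * (m l)`!%:R)) * zeta_coeff m.
Proof.
move=> eps0 ok; rewrite /zeta_des; case: asboolP => [[k [n]]|_].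
  rewrite mxE => /eqP; rewrite eq_sym -subr_eq0 opprK -natrD.
  by rewrite pnatr_eq0.
set P := \prod_(l < r) _; rewrite /zeta_des_formula.
have tp0 : tp != 0 by rewrite eq_complex /= eqxx /= gt_eqF // two_pi_gt0.
have prefE : \prod_(k < r) hankel_prefactor ((\row_j - (m j)%:R : 'rV[C]_r) 0 k) =
    P / tp ^+ r.
  rewrite (eq_bigr (fun k => (-1) ^+ m k * (m k)`!%:R / tp)) => [|k _]; last first.
    by rewrite mxE hankel_prefactorE.
  by rewrite big_split /= prodr_const card_ord exprVn.
rewrite prefE; apply: cvg_lim => //.
have lim_c : P * family_coeff (coeff_weight (fun n => (h_quot c n)%:C)) m
    @[c --> (1 : R)^'] --> P * zeta_coeff m.
  apply: cvgCM; first exact: cvg_cst.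
  apply: cvgC_sum => nu; apply: cvgC_prod => j; apply: cvgCM; last exact: cvg_cst.
  apply: cvgCM; last exact: cvg_cst; apply: cvgCM; last exact: cvg_cst.
  by apply: cvg_real_complex; exact: h_quot_cvg.
apply: cvgC_near_eq lim_c.
have near12 : \forall c \near (1 : R)^', c != 1 /\ 2^-1 <= c <= 2.
  apply/nbhs_ballP; exists 2^-1 => [|c]; first by rewrite /= invr_gt0.
  rewrite -ball_normE /= distrC ltr_norml => /andP[h1 h2] c1.
  by split=> //; apply/andP; split; lra.
apply: filterS near12 => c [c1 c12].
rewrite hankel_iter_Htilde //.
have hE n : (h_coeff c n)%:C = (1 - c)%:C * (h_quot c n)%:C.
  rewrite -rmorphM; congr (_%:C); rewrite /h_coeff /h_quot mulrCA; congr (_ * _).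
  by rewrite -[LHS]opprB subrX1 -mulNr opprB.
have -> : family_coeff (coeff_weight (fun n => (h_coeff c n)%:C)) m =
    (1 - c)%:C ^+ r * family_coeff (coeff_weight (fun n => (h_quot c n)%:C)) m.
  rewrite /family_coeff mulr_sumr; apply: eq_bigr => nu _; rewrite /weight.
  rewrite -[in (1 - c)%:C ^+ r](card_ord r) -prodr_const -big_split.
  by apply: eq_bigr => j _; rewrite /coeff_weight /= hE !mulrA.
have c10 : c%:C - 1 != 0 :> C by rewrite subr_eq0 -(inj_eq (@complexI R)) in c1 *.
(* This sign cancels the (-1)^r of the defining formula. *)
have -> : (1 - c)%:C ^+ r = (-1) ^+ r * (c%:C - 1) ^+ r :> C.
  by rewrite -exprMn mulN1r opprB rmorphB.
set Q := family_coeff _ _; set X := (c%:C - 1) ^+ r.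
have X0 : X != 0 by rewrite expf_neq0.
have T0 : tp ^+ r != 0 by rewrite expf_neq0.
have s1 : (-1) ^+ r * (-1) ^+ r = 1 :> C by rewrite -exprMn mulrNN mulr1 expr1n.
transitivity ((-1) ^+ r * (-1) ^+ r * (P * Q)); first by rewrite s1 mul1r.
move: X0 T0; move: X (tp ^+ r) ((-1) ^+ r : C) => X T sg X0 T0.
by field; rewrite X0 T0.
Qed.

(** B_(n+1) = (n+1)! [bern (n+1)] = n! [phi_coeff n], and [family] unfolds to [nu_family]. *)
Lemma zeta_coeffE m :
  zeta_coeff m = \sum_(nu : 'M['I_(\max_(j < r) m j).+1]_(r, r) | nu_family m nu)
    \prod_(j < r)
      ((bernoulli_number R (1 + \sum_(l < r | (j <= l)%N) nu j l)%N)%:C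
       * gamma 0 j ^+ (\sum_(l < r | (j <= l)%N) nu j l)%N
       / (\prod_(d < r | (d <= j)%N) (nu d j)`!)%:R).
Proof.
apply: eq_bigr => nu _; apply: eq_bigr => j _; congr (_ / _).
rewrite /coeff_weight mulrAC -/(row_sum nu j) add1n bernoulli_numberE /phi_coeff.
by rewrite factS natrM !rmorphM !rmorph_nat; ring.
Qed.

Lemma zeta_coeff_cvg eps t : radius_ok eps -> (forall l, cabs (t 0 l) <= eps) ->
  partial_sum (fun m => zeta_coeff m * monomial (fun l => t 0 l) m) @ totally -->
  \prod_j extend0 (fun x => ((1 - x) * expC x - 1) / (expC x - 1) ^+ 2)
                  (tail_form gamma t j).
Proof.
move=> ok te; apply: family_sum_cvg => [j n|j].
  rewrite /coeff_weight mulfK ?fact_neq0 // cabsM cabsX -mulrA -exprMn.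
  rewrite -[leRHS]mul1r.
  have S0 : 0 <= cabs (gamma 0 j) * (\sum_(l < r | (j <= l)%N) cabs (t 0 l)).
    by rewrite mulr_ge0 ?cabs_ge0 // sumr_ge0 // => *; exact: cabs_ge0.
  (* The hypothesis of [family_sum_cvg] is the geometric bound at the real point |gamma_j| (|t_j| +
     ... + |t_r|), which [radius_ok] keeps at most 1/8. *)
  have := @cabs_geo (fun n => (phi_coeff R n)%:C) 1
    (cabs (gamma 0 j) * (\sum_(l < r | (j <= l)%N) cabs (t 0 l)))%:C n.
  rewrite cabsM cabsX cabs_real (ger0_norm S0); apply; first exact: ok te.
  exact: phi_coeff_le.
under eq_cvg do under eq_bigr do rewrite coeff_weightE.
by apply: extend0_phi_series; exact: cabs_tail_form ok te.
Qed.

End ZetaDes.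

Unset Implicit Arguments.

Theorem theorem1p22 (R : realType) (r : nat) (hr : (0 < r)%N)
    (gamma : 'rV[R[i]]_r) (hgamma : forall j, 0 < complex.Re (gamma 0 j)) :
  \forall eps \near (0 : R)^'+,
    let zeta (m : {ffun 'I_r -> nat}) : R[i] :=
      zeta_des eps gamma (\row_j - (m j)%:R) in
    (\forall t \near (0 : 'rV[R[i]]_r),
       partial_sum
         (fun m : {ffun 'I_r -> nat} =>
            (-1) ^+ (\sum_(j < r) m j)%N * zeta m
              * \prod_(j < r) ((t : 'rV[R[i]]_r) 0 j ^+ m j / (m j)`!%:R))
       @ totally -->
       \prod_(j < r)
         extend0 (fun x => ((1 - x) * expC x - 1) / (expC x - 1) ^+ 2)
                 (tail_form gamma t j))
    /\
    (forall k : {ffun 'I_r -> nat},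
       zeta k =
       (\prod_(l < r) ((-1) ^+ k l * (k l)`!%:R))
       * \sum_(nu : 'M['I_(\max_(j < r) k j).+1]_(r, r) | nu_family k nu)
           \prod_(j < r)
             ((bernoulli_number R (1 + \sum_(l < r | (j <= l)%N) nu j l)%N)%:C
              * gamma 0 j ^+ (\sum_(l < r | (j <= l)%N) nu j l)%N
              / (\prod_(d < r | (d <= j)%N) (nu d j)`!)%:R)).
Proof.
near=> eps.
have ok : radius_ok gamma eps by near: eps; exact: near_radius_ok.
have eps0 : 0 < eps by near: eps; exact: nbhs_right_gt.
have zetaE (m : {ffun 'I_r -> nat}) : zeta_des eps gamma (\row_j - (m j)%:R) =
    (\prod_(l < r) ((-1) ^+ m l * (m l)`!%:R)) * zeta_coeff gamma m.
  exact: zeta_des_negint.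
split=> [|k]; last by rewrite zetaE zeta_coeffE.
(* The radius of the contour also serves as the radius of the expansion. *)
apply/nbhs_ballP; exists eps%:C => [|t teps]; first by rewrite /= ltcR.
have te l : cabs (t 0 l) <= eps.
  case: teps => _ /(_ 0 l); rewrite -ball_normE /= mxE sub0r normrN normC_cabs ltcR.
  exact: ltW.
rewrite (_ : (fun m : {ffun 'I_r -> nat} => _) =
    fun m => zeta_coeff gamma m * monomial (fun l => t 0 l) m).
  exact: zeta_coeff_cvg ok te.
apply/funext => m; rewrite zetaE -prodrXr mulrA -big_split mulrAC -big_split /=.
rewrite [LHS]mulrC; congr (_ * _); apply: eq_bigr => j _.
(* The sign occurs once in the series and once in the zeta value. *)
have sg : (-1) ^+ m j * (-1) ^+ m j = 1 :> R[i].
  by rewrite -exprMn mulrNN mulr1 expr1n.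
by rewrite [_ * (_ * (m j)`!%:R)]mulrA sg mul1r mulrC divfK ?fact_neq0.
Unshelve. all: by end_near. Qed.
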